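(* For every countably infinite, non-amenable discrete group $\Gamma$, there exist a compact metric space $X$ and a free action of $\Gamma$ on $X$ by homeomorphisms such that the full crossed product $C(X)\rtimes_f\Gamma$ has an exotic ideal, i.e. a non-zero ideal $J$ of $C(X)\rtimes_f\Gamma$ with $J\cap C(X)=\{0\}$.
   Context: ''Ideal'' in a $C^*$-algebra means closed two-sided ideal. An action of $\Gamma$ on $X$ is free if $sx\neq x$ for every $x\in X$ and every $e\neq s\in\Gamma$. With $\tau_s(a)(x)=a(s^{-1}x)$ for $a\in C(X)$, $C_c(\Gamma,C(X))$ is the $*$-algebra of finitely supported functions $\Gamma\to C(X)$ with $(ab)(t)=\sum_{s}a(s)\tau_s(b(s^{-1}t))$ and $a^*(t)=\tau_t(a(t^{-1}))^*$. $C(X)\rtimes_f\Gamma$ is the full crossed product, the completion of $C_c(\Gamma,C(X))$ in the full (largest) $C^*$-norm. $C(X)$ is regarded as the subalgebra of functions supported at $e\in\Gamma$. *)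

(* Defs.v *)
From HB Require Import structures.
From mathcomp Require Import all_boot all_order all_algebra.
From mathcomp Require Import finmap.
From mathcomp Require Export complex.
From mathcomp Require Import all_classical all_reals all_analysis.

Set Implicit Arguments.
Unset Strict Implicit.
Unset Printing Implicit Defensive.

Import Order.TTheory GRing.Theory Num.Theory.
Import numFieldNormedType.Exports.

Local Open Scope classical_set_scope.
Local Open Scope ring_scope.

Definition amenable (R : realType) (G : groupType) : Prop :=
  exists m : set G -> R,
    [/\ forall A, 0 <= m A,
        m [set: G] = 1,
        forall A B, A `&` B = set0 -> m (A `|` B) = m A + m B &
        forall s A, m [set (s * t)%g | t in A] = m A].

(* A non-empty metric space: [algType] below excludes the zero ring, which C(X)
   is for empty X. *)
#[short(type="pmetricType")]
HB.structure Definition PointedMetric (K : numDomainType) :=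
  {M of Metric K M & Pointed M}.

HB.mixin Record isStarAlgebra (C : numClosedFieldType) A
    of GRing.Algebra C A := {
  star : A -> A;
  starK : involutive star;
  starD : {morph star : x y / x + y};
  starZ : forall (k : C) (x : A), star (k *: x) = k^* *: star x;
  starM : forall x y : A, star (x * y) = star y * star x
}.

#[short(type="starAlgType")]
HB.structure Definition StarAlgebra (C : numClosedFieldType) :=
  {A of GRing.Algebra C A & isStarAlgebra C A}.

(* As for [`|_|], norms take their values in C; [0 <= p x] makes them real. *)
Definition cstar_norm (C : numClosedFieldType) (A : starAlgType C)
    (p : A -> C) : Prop :=
  (forall x, 0 <= p x) /\
  (forall x, p x = 0 -> x = 0) /\
  (forall x y, p (x + y) <= p x + p y) /\
  (forall k x, p (k *: x) = `|k| * p x) /\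
  (forall x y, p (x * y) <= p x * p y) /\
  (forall x, p (star x * x) = p x ^+ 2).

Definition largest_cstar_norm (C : numClosedFieldType) (A : starAlgType C)
    (p : A -> C) : Prop :=
  cstar_norm p /\ forall q, cstar_norm q -> forall x, q x <= p x.

Definition norm_complete (C : numClosedFieldType) (A : zmodType)
    (p : A -> C) : Prop :=
  forall u : nat -> A,
    (forall e, 0 < e -> exists N, forall m n,
       (N <= m)%N -> (N <= n)%N -> p (u m - u n) < e) ->
    exists l, forall e, 0 < e -> exists N, forall n,
      (N <= n)%N -> p (u n - l) < e.

(* The norm is not MathComp-Analysis's [`|_|]: Hierarchy-Builder has no common
   subclass of [algType] and [normedModType]. *)
HB.mixin Record isCstarAlgebra (C : numClosedFieldType) A
    of StarAlgebra C A := {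
  cnorm : A -> C;
  cnorm_cstar : cstar_norm cnorm;
  cnorm_complete : norm_complete cnorm
}.

#[short(type="cstarAlgType")]
HB.structure Definition CstarAlgebra (C : numClosedFieldType) :=
  {A of StarAlgebra C A & isCstarAlgebra C A}.

Definition cclosure (C : numClosedFieldType) (A : cstarAlgType C)
    (S : set A) : set A :=
  [set x | forall e : C, 0 < e -> exists2 y, S y & cnorm (x - y) < e].

Definition closed_ideal (C : numClosedFieldType) (A : cstarAlgType C)
    (J : set A) : Prop :=
  [/\ cclosure J `<=` J, J 0,
      forall x y, J x -> J y -> J (x + y) &
      forall a x, J x -> J (a * x) /\ J (x * a)].

(* The *-algebra C(X), with pointwise operations. *)
Definition contC (C : numClosedFieldType) (X : topologicalType) : Type :=
  continuousType X C.

Section ContC.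
Context (C : numClosedFieldType) (X : ptopologicalType).
Implicit Types (f g h : contC C X).

HB.instance Definition _ := Choice.on (contC C X).

Definition contC_fun f : X -> C := f.
Local Coercion contC_fun : contC >-> Funclass.

Definition mkcontC (f : X -> C) (cf : continuous f) : contC C X :=
  (mkcts cf : continuousType X C).

Lemma mkcontCE (f : X -> C) (cf : continuous f) x : mkcontC cf x = f x.
Proof. by []. Qed.

Lemma contC_cont f : continuous f.
Proof. exact: cts_fun. Qed.

Lemma contCP f g : (forall x, f x = g x) -> f = g.
Proof. by move=> fg; apply/continuousEP. Qed.

Lemma conjC_continuous : continuous (fun z : C => z^*).
Proof.
move=> z P /nbhs_ballP[e e0 eP]; apply/nbhs_ballP; exists e => // w zw.
by apply: eP; move: zw; rewrite -!ball_normE /= -rmorphB norm_conjC.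
Qed.

Fact contC_add_cont f g : continuous (fun x => f x + g x).
Proof. by move=> x; apply: cvgD; apply: contC_cont. Qed.
Fact contC_opp_cont f : continuous (fun x => - f x).
Proof. by move=> x; apply: cvgN; apply: contC_cont. Qed.
Fact contC_mul_cont f g : continuous (fun x => f x * g x).
Proof. by move=> x; apply: cvgM; apply: contC_cont. Qed.
Fact contC_cst_cont (c : C) : continuous (fun _ : X => c).
Proof. by move=> x; apply: cvg_cst. Qed.
Fact contC_scale_cont (c : C) f : continuous (fun x => c * f x).
Proof. by move=> x; apply: cvgM; [apply: cvg_cst|apply: contC_cont]. Qed.
Fact contC_star_cont f : continuous (fun x => (f x)^*).
Proof.
move=> x; apply: (@continuous_comp _ _ _ f (fun z : C => z^*)).
  exact: contC_cont.
exact: conjC_continuous.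
Qed.

Definition contC_add f g := mkcontC (@contC_add_cont f g).
Definition contC_opp f := mkcontC (@contC_opp_cont f).
Definition contC_mul f g := mkcontC (@contC_mul_cont f g).
Definition contC_cst c := mkcontC (@contC_cst_cont c).
Definition contC_scale c f := mkcontC (@contC_scale_cont c f).
Definition contC_star f := mkcontC (@contC_star_cont f).

Fact contC_addA : associative contC_add.
Proof. by move=> f g h; apply: contCP => x; rewrite !mkcontCE addrA. Qed.
Fact contC_addC : commutative contC_add.
Proof. by move=> f g; apply: contCP => x; rewrite !mkcontCE addrC. Qed.
Fact contC_add0 : left_id (contC_cst 0) contC_add.
Proof. by move=> f; apply: contCP => x; rewrite !mkcontCE add0r. Qed.
Fact contC_addN : left_inverse (contC_cst 0) contC_opp contC_add.
Proof. by move=> f; apply: contCP => x; rewrite !mkcontCE addNr. Qed.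

HB.instance Definition _ := GRing.isZmodule.Build (contC C X)
  contC_addA contC_addC contC_add0 contC_addN.

Fact contC_mulA : associative contC_mul.
Proof. by move=> f g h; apply: contCP => x; rewrite !mkcontCE mulrA. Qed.
Fact contC_mul1 : left_id (contC_cst 1) contC_mul.
Proof. by move=> f; apply: contCP => x; rewrite !mkcontCE mul1r. Qed.
Fact contC_1mul : right_id (contC_cst 1) contC_mul.
Proof. by move=> f; apply: contCP => x; rewrite !mkcontCE mulr1. Qed.
Fact contC_mulDl : left_distributive contC_mul +%R.
Proof. by move=> f g h; apply: contCP => x; apply: mulrDl. Qed.
Fact contC_mulDr : right_distributive contC_mul +%R.
Proof. by move=> f g h; apply: contCP => x; apply: mulrDr. Qed.

Fact contC_oner_neq0 : contC_cst 1 != 0.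
Proof.
by apply/eqP => /(congr1 (contC_fun^~ point)) /eqP; apply/negP/oner_neq0.
Qed.

HB.instance Definition _ := GRing.Zmodule_isNzRing.Build (contC C X)
  contC_mulA contC_mul1 contC_1mul contC_mulDl contC_mulDr contC_oner_neq0.

Fact contC_scaleA a b f : contC_scale a (contC_scale b f) = contC_scale (a * b) f.
Proof. by apply: contCP => x; apply: mulrA. Qed.
Fact contC_scale1 : left_id 1 contC_scale.
Proof. by move=> f; apply: contCP => x; apply: mul1r. Qed.
Fact contC_scaleDr : right_distributive contC_scale +%R.
Proof. by move=> a f g; apply: contCP => x; apply: mulrDr. Qed.
Fact contC_scaleDl f : {morph contC_scale^~ f : a b / a + b}.
Proof. by move=> a b; apply: contCP => x; apply: mulrDl. Qed.

HB.instance Definition _ := GRing.Zmodule_isLmodule.Build C (contC C X)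
  contC_scaleA contC_scale1 contC_scaleDr contC_scaleDl.

Fact contC_scaleAl (k : C) f g : k *: (f * g) = k *: f * g.
Proof. by apply: contCP => x; apply: mulrA. Qed.

HB.instance Definition _ :=
  GRing.Lmodule_isLalgebra.Build C (contC C X) contC_scaleAl.

Fact contC_scaleAr (k : C) f g : k *: (f * g) = f * (k *: g).
Proof. by apply: contCP => x; apply: mulrCA. Qed.

HB.instance Definition _ :=
  GRing.Lalgebra_isAlgebra.Build C (contC C X) contC_scaleAr.

Fact contC_starK : involutive contC_star.
Proof. by move=> f; apply: contCP => x; apply: conjCK. Qed.
Fact contC_starD : {morph contC_star : f g / f + g}.
Proof. by move=> f g; apply: contCP => x; apply: rmorphD. Qed.
Fact contC_starZ (k : C) f : contC_star (k *: f) = k^* *: contC_star f.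
Proof. by apply: contCP => x; apply: rmorphM. Qed.
Fact contC_starM f g : contC_star (f * g) = contC_star g * contC_star f.
Proof. by apply: contCP => x; rewrite mkcontCE rmorphM mulrC. Qed.

HB.instance Definition _ := isStarAlgebra.Build C (contC C X)
  contC_starK contC_starD contC_starZ contC_starM.

End ContC.

Coercion contC_fun : contC >-> Funclass.

(* By [act1] and [actM], every [act s] is a homeomorphism. *)
Record top_action (G : groupType) (X : topologicalType) := TopAction {
  act :> G -> X -> X;
  act1 : forall x, act 1%g x = x;
  actM : forall s t x, act (s * t)%g x = act s (act t x);
  act_continuous : forall s, continuous (act s)
}.

Definition free_action (G : groupType) (X : topologicalType)
    (alpha : top_action G X) : Prop :=
  forall (s : G) (x : X), s != 1%g -> alpha s x <> x.

Definition supp (C : numClosedFieldType) (G : groupType) (X : ptopologicalType)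
    (a : G -> contC C X) : set G :=
  [set t | a t != 0].

(* The carrier of C_c(G, C(X)). Its algebra structure below depends on the
   action, which is therefore a parameter of the type. *)
Record Cc (C : numClosedFieldType) (G : groupType) (X : ptopologicalType)
    (alpha : top_action G X) := MkCc {
  Cc_fun :> G -> contC C X;
  Cc_finite : finite_set (supp Cc_fun)
}.

Section CrossedProduct.
Context (C : numClosedFieldType) (G : groupType) (X : ptopologicalType).
Context (alpha : top_action G X).
Implicit Types (s t : G) (f g : contC C X).

Fact translate_cont s f : continuous (fun x => f (alpha s^-1%g x)).
Proof.
move=> x; apply: (@continuous_comp _ _ _ (alpha s^-1%g) f).
  exact: act_continuous.
exact: contC_cont.
Qed.

Definition translate s f : contC C X := mkcontC (@translate_cont s f).

Lemma translate1 f : translate 1%g f = f.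
Proof. by apply: contCP => x; rewrite mkcontCE invg1 act1. Qed.
Lemma translate_comp s t f :
  translate s (translate t f) = translate (s * t)%g f.
Proof. by apply: contCP => x; rewrite !mkcontCE invgM actM. Qed.
Lemma translateD s : {morph translate s : f g / f + g}.
Proof. by move=> f g; apply: contCP. Qed.
Lemma translate0 s : translate s 0 = 0.
Proof. by apply: contCP. Qed.
Lemma translateM s : {morph translate s : f g / f * g}.
Proof. by move=> f g; apply: contCP. Qed.
Lemma translate_1 s : translate s 1 = 1.
Proof. by apply: contCP. Qed.
Lemma translateZ s (k : C) f : translate s (k *: f) = k *: translate s f.
Proof. by apply: contCP. Qed.
Lemma translate_star s f : translate s (star f) = star (translate s f).
Proof. by apply: contCP. Qed.
Lemma translate_sum s (I : Type) (r : seq I) (F : I -> contC C X) :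
  translate s (\sum_(i <- r) F i) = \sum_(i <- r) translate s (F i).
Proof. exact: (big_morph _ (translateD s) (translate0 s)). Qed.

Lemma fsum_supp (F : G -> contC C X) (S : set G) : finite_set S ->
  supp F `<=` S -> \sum_(s \in [set: G]) F s = \sum_(s <- fset_set S) F s.
Proof.
move=> finS FS; rewrite -fsbig_finite//; apply/esym; apply: fsbig_widen => //.
move=> s [_ nSs] /=; apply/eqP/negP => /negP Fs.
by apply: nSs; apply: FS.
Qed.

Local Notation Cc := (@Cc C G X alpha).
Local Notation MkCc := (@MkCc C G X alpha).
Implicit Types (a b c : Cc).

HB.instance Definition _ := gen_eqMixin Cc.
HB.instance Definition _ := gen_choiceMixin Cc.

Lemma CcP a b : (forall t, a t = b t) -> a = b.
Proof.
case: a b => [a fa] [b fb] /= /funext ab; case: _ / ab fb => fb.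
by congr MkCc; apply: Prop_irrelevance.
Qed.

Fact Cc_zero_fin : finite_set (supp (fun _ : G => 0 : contC C X)).
Proof.
by rewrite (_ : supp _ = set0)// -subset0 => t; rewrite /supp /= eqxx.
Qed.
Fact Cc_add_fin a b : finite_set (supp (fun t => a t + b t)).
Proof.
apply: (@sub_finite_set _ _ (supp a `|` supp b)).
  move=> t; rewrite /supp /=; case: (eqVneq (a t) 0) => [->|]; last by left.
  by rewrite add0r; right.
by rewrite finite_setU; split; exact: Cc_finite.
Qed.
Fact Cc_opp_fin a : finite_set (supp (fun t => - a t)).
Proof.
apply: sub_finite_set (Cc_finite a) => t.
by rewrite /supp /= oppr_eq0.
Qed.
Fact Cc_scale_fin (k : C) a : finite_set (supp (fun t => k *: a t)).
Proof.
apply: sub_finite_set (Cc_finite a) => t.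
by rewrite /supp /=; apply: contra_neq => ->; rewrite scaler0.
Qed.
Fact Cc_embed_fin f : finite_set (supp (fun t => if t == 1%g then f else 0)).
Proof.
apply: (@sub_finite_set _ _ [set 1%g]) => // t; rewrite /supp /=.
by case: (t =P 1%g) => // _; rewrite eqxx.
Qed.

Definition conv (a b : G -> contC C X) (t : G) : contC C X :=
  \sum_(s \in [set: G]) a s * translate s (b (s^-1 * t)%g).

Lemma convE (a b : G -> contC C X) (S : set G) t :
  finite_set S -> supp a `<=` S ->
  conv a b t = \sum_(s <- fset_set S) a s * translate s (b (s^-1 * t)%g).
Proof.
move=> finS aS; apply: fsum_supp => // s; rewrite /supp /= => abs.
by apply: aS; apply: contra_neq abs => ->; rewrite mul0r.
Qed.

Fact Cc_mul_fin a b : finite_set (supp (conv a b)).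
Proof.
apply: (@sub_finite_set _ _ [set (s * t)%g | s in supp a & t in supp b]).
  2: by apply: finite_image2; exact: Cc_finite.
move=> t; rewrite /supp /= => abt; apply: contrapT => nex.
move/eqP: abt; apply; rewrite /conv; apply: fsbig1 => s _.
case: (eqVneq (a s) 0) => [->|as0]; first by rewrite mul0r.
case: (eqVneq (b (s^-1 * t)%g) 0) => [->|bs0].
  by rewrite translate0 mulr0.
case: nex; exists s => //; exists (s^-1 * t)%g => //.
by rewrite mulgA mulgV mul1g.
Qed.

Fact Cc_star_fin a :
  finite_set (supp (fun t => star (translate t (a t^-1%g)))).
Proof.
apply: (@sub_finite_set _ _ ((fun t => t^-1%g) @` supp a)).
  move=> t; rewrite /supp /= => h; exists t^-1%g; last exact: invgK.
  by apply: contra_neq h => ->; rewrite translate0; apply: contCP => x; exact: conjC0.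
exact/finite_image/Cc_finite.
Qed.

Definition Cc_zero := MkCc Cc_zero_fin.
Definition Cc_add a b := MkCc (Cc_add_fin a b).
Definition Cc_opp a := MkCc (Cc_opp_fin a).
Definition Cc_scale k a := MkCc (Cc_scale_fin k a).
Definition Cc_mul a b := MkCc (Cc_mul_fin a b).
Definition Cc_star a := MkCc (Cc_star_fin a).
(* C(X) as the functions supported at the identity. *)
Definition Cc_embed f := MkCc (Cc_embed_fin f).

Fact Cc_addA : associative Cc_add.
Proof. by move=> a b c; apply: CcP => t; apply: addrA. Qed.
Fact Cc_addC : commutative Cc_add.
Proof. by move=> a b; apply: CcP => t; apply: addrC. Qed.
Fact Cc_add0 : left_id Cc_zero Cc_add.
Proof. by move=> a; apply: CcP => t; apply: add0r. Qed.
Fact Cc_addN : left_inverse Cc_zero Cc_opp Cc_add.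
Proof. by move=> a; apply: CcP => t; apply: addNr. Qed.

HB.instance Definition _ := GRing.isZmodule.Build Cc
  Cc_addA Cc_addC Cc_add0 Cc_addN.

Lemma sum_fset1 (F : G -> contC C X) s : \sum_(i <- fset_set [set s]) F i = F s.
Proof. by rewrite -fsbig_finite// fsbig_set1. Qed.

Fact Cc_mulA : associative Cc_mul.
Proof.
move=> a b c; apply: CcP => t /=; apply/esym.
pose S := [set (s * t)%g | s in supp a & t in supp b].
have finS : finite_set S by apply: finite_image2; exact: Cc_finite.
have abS : supp (conv a b) `<=` S.
  move=> s; rewrite /supp /= => /eqP abs; apply: contrapT => nex; apply: abs.
  rewrite /conv; apply: fsbig1 => r _.
  case: (eqVneq (a r) 0) => [->|ar0]; first by rewrite mul0r.
  case: (eqVneq (b (r^-1 * s)%g) 0) => [->|br0].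
    by rewrite translate0 mulr0.
  case: nex; exists r => //; exists (r^-1 * s)%g => //.
  by rewrite mulgA mulgV mul1g.
rewrite (convE _ _ finS abS) (convE _ _ (Cc_finite a) (@subset_refl _ _)).
under eq_bigr => s _.
  rewrite (convE _ _ (Cc_finite a) (@subset_refl _ _)) mulr_suml.
  over.
rewrite exchange_big /= big_seq [RHS]big_seq; apply: eq_bigr => r.
rewrite in_fset_set ?inE; last exact: Cc_finite.
move=> ar; under eq_bigr do rewrite -mulrA.
rewrite -mulr_sumr; congr (_ * _).
rewrite (convE _ _ (Cc_finite b) (@subset_refl _ _)) translate_sum.
rewrite -[LHS](@fsum_supp (fun s => translate r (b (r^-1 * s)%g) *
    translate s (c (s^-1 * t)%g))) //; last first.
  move=> s; rewrite /supp /= => h.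
  exists r => //; exists (r^-1 * s)%g; last by rewrite mulgA mulgV mul1g.
  by apply: contra_neq h => ->; rewrite translate0 mul0r.
rewrite (reindex_fsbigT (fun u => r * u)%g); last first.
  exists (fun u => r^-1 * u)%g => u.
    by rewrite mulgA mulVg mul1g.
  by rewrite mulgA mulgV mul1g.
rewrite -[RHS](@fsum_supp (fun u => translate r (b u * translate u
    (c (u^-1 * (r^-1 * t))%g)))); first last.
- move=> u; rewrite /supp /=; apply: contra_neq => ->.
  by rewrite mul0r translate0.
- exact: Cc_finite.
apply: eq_fsbigr => u _.
by rewrite translateM translate_comp mulgA mulVg mul1g invgM -mulgA.
Qed.

Fact Cc_mul1 : left_id (Cc_embed 1) Cc_mul.
Proof.
move=> a; apply: CcP => t /=; rewrite (@convE _ _ [set 1%g])//.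
  by rewrite sum_fset1 /= eqxx mul1r translate1 invg1 mul1g.
by move=> s; rewrite /supp /=; case: (s =P 1%g) => // _; rewrite eqxx.
Qed.

Fact Cc_1mul : right_id (Cc_embed 1) Cc_mul.
Proof.
move=> a; apply: CcP => t /=; rewrite /conv (@fsum_supp _ [set t])//.
  by rewrite sum_fset1 /= mulVg eqxx translate_1 mulr1.
move=> s; rewrite /supp /=; case: (_ =P 1%g) => [st|]; last first.
  by rewrite translate0 mulr0 eqxx.
by move=> _; apply/esym; rewrite -[t]mul1g -(mulgV s) -mulgA st mulg1.
Qed.

Fact Cc_mulDl : left_distributive Cc_mul +%R.
Proof.
move=> a b c; apply: CcP => t /=.
pose S := supp a `|` supp b.
have finS : finite_set S by rewrite finite_setU; split; exact: Cc_finite.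
rewrite !(@convE _ _ S)//; [|by move=> ?; right|by move=> ?; left|].
  by rewrite -big_split; apply: eq_bigr => s _; apply: mulrDl.
move=> s; rewrite /supp /S /=; case: (eqVneq (a s) 0) => [->|]; last by left.
by rewrite add0r; right.
Qed.

Fact Cc_mulDr : right_distributive Cc_mul +%R.
Proof.
move=> a b c; apply: CcP => t /=.
rewrite !(convE _ _ (Cc_finite a) (@subset_refl _ _)) -big_split.
by apply: eq_bigr => s _; rewrite translateD; apply: mulrDr.
Qed.

Fact Cc_oner_neq0 : Cc_embed 1 != 0.
Proof.
apply/eqP => /(congr1 (fun a : Cc => a 1%g)) /=; rewrite eqxx.
by apply/eqP/oner_neq0.
Qed.

HB.instance Definition _ := GRing.Zmodule_isNzRing.Build Cc
  Cc_mulA Cc_mul1 Cc_1mul Cc_mulDl Cc_mulDr Cc_oner_neq0.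

Fact Cc_scaleA (k l : C) a : Cc_scale k (Cc_scale l a) = Cc_scale (k * l) a.
Proof. by apply: CcP => t; apply: scalerA. Qed.
Fact Cc_scale1 : left_id 1 Cc_scale.
Proof. by move=> a; apply: CcP => t; apply: scale1r. Qed.
Fact Cc_scaleDr : right_distributive Cc_scale +%R.
Proof. by move=> k a b; apply: CcP => t; apply: scalerDr. Qed.
Fact Cc_scaleDl a : {morph Cc_scale^~ a : k l / k + l}.
Proof. by move=> k l; apply: CcP => t; apply: scalerDl. Qed.

HB.instance Definition _ := GRing.Zmodule_isLmodule.Build C Cc
  Cc_scaleA Cc_scale1 Cc_scaleDr Cc_scaleDl.

Fact Cc_scaleAl (k : C) a b : k *: (a * b) = k *: a * b.
Proof.
apply: CcP => t /=; rewrite !(convE _ _ (Cc_finite a)) //.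
  by rewrite scaler_sumr; apply: eq_bigr => s _; apply: scalerAl.
by move=> s; rewrite /supp /=; apply: contra_neq => ->; rewrite scaler0.
Qed.

HB.instance Definition _ := GRing.Lmodule_isLalgebra.Build C Cc Cc_scaleAl.

Fact Cc_scaleAr (k : C) a b : k *: (a * b) = a * (k *: b).
Proof.
apply: CcP => t /=; rewrite !(convE _ _ (Cc_finite a)) //.
rewrite scaler_sumr; apply: eq_bigr => s _.
by rewrite translateZ; apply: scalerAr.
Qed.

HB.instance Definition _ := GRing.Lalgebra_isAlgebra.Build C Cc Cc_scaleAr.

Fact Cc_starK : involutive Cc_star.
Proof.
move=> a; apply: CcP => t /=.
by rewrite translate_star starK translate_comp mulgV translate1 invgK.
Qed.
Fact Cc_starD : {morph Cc_star : a b / a + b}.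
Proof. by move=> a b; apply: CcP => t /=; rewrite translateD starD. Qed.
Fact Cc_starZ (k : C) a : Cc_star (k *: a) = k^* *: Cc_star a.
Proof. by apply: CcP => t /=; rewrite translateZ starZ. Qed.

Fact Cc_starM a b : Cc_star (a * b) = Cc_star b * Cc_star a.
Proof.
have star0 : star 0 = 0 :> contC C X by apply: contCP => x; exact: conjC0.
apply: CcP => t /=.
rewrite (convE _ _ (Cc_finite a) (@subset_refl _ _)) translate_sum.
rewrite (big_morph _ (@starD _ _) star0).
rewrite -[LHS](@fsum_supp (fun s => star (translate t
   (a s * translate s (b (s^-1 * t^-1)%g))))); first last.
- move=> s; rewrite /supp /=; apply: contra_neq => ->.
  by rewrite mul0r translate0 star0.
- exact: Cc_finite.
rewrite /conv (reindex_fsbigT (fun u => t^-1 * u)%g); last first.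
  exists (fun u => t * u)%g => u.
    by rewrite mulgA mulgV mul1g.
  by rewrite mulgA mulVg mul1g.
apply: eq_fsbigr => u _; rewrite translateM starM translate_comp.
rewrite !mulgA mulgV mul1g; congr (_ * _).
  by rewrite invgM invgK mulgK.
by rewrite translate_star translate_comp mulgA mulgV mul1g invgM invgK.
Qed.

HB.instance Definition _ := isStarAlgebra.Build C Cc
  Cc_starK Cc_starD Cc_starZ Cc_starM.

End CrossedProduct.

Arguments Cc C {G X} alpha.
Arguments Cc_embed {C G X} alpha f.

(* The completion of C_c(G, C(X)) in its largest C*-norm, which determines it up
   to isometric *-isomorphism. *)
Record fullCrossedProduct (C : numClosedFieldType) (G : groupType)
    (X : ptopologicalType) (alpha : top_action G X) := FullCrossedProduct {
  fcp_alg :> cstarAlgType C;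
  fcp_map : {lrmorphism Cc C alpha -> fcp_alg};
  fcp_map_star : {morph fcp_map : a / star a};
  fcp_norm : largest_cstar_norm (fun a => cnorm (fcp_map a));
  fcp_dense : cclosure (range fcp_map) = [set: fcp_alg]
}.
Arguments fullCrossedProduct C {G X} alpha.

Definition fcp_contC (C : numClosedFieldType) (G : groupType)
    (X : ptopologicalType) (alpha : top_action G X)
    (A : fullCrossedProduct C alpha) : set A :=
  range (fun f => fcp_map A (Cc_embed alpha f)).
Arguments fcp_contC {C G X alpha} A.

Definition exotic_ideal (C : numClosedFieldType) (G : groupType)
    (X : ptopologicalType) (alpha : top_action G X)
    (A : fullCrossedProduct C alpha) (J : set A) : Prop :=
  [/\ closed_ideal J, J <> [set 0] & J `&` fcp_contC A = [set 0]].

(* Main.v *)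
Require Import Defs.
From HB Require Import structures.
From mathcomp Require Import all_boot all_order all_algebra.
From mathcomp Require Import finmap ring lra generic_quotient.
From mathcomp Require Import all_classical all_reals all_analysis.

(* X is the set of families (z_s), s in G, of colourings z_s of G by Z/n_s with
   z_s(t s) = z_s(t) + 1, where n_s is the order of s (and 2 if it is infinite);
   G acts by left translation, freely because n_s > 1 for s <> 1. Rotating z_s
   along a left coset of <s> gives commuting homeomorphisms permuted by G.
   Averages over finitely many rotations bring any continuous function uniformly
   close to a constant, and since they commute this constant is unique: it is a
   G-invariant state on C(X).
   The Koopman representation of this state makes the full norm of
   u_(s_1) + ... + u_(s_k) equal to k. If the reduced norm were always at least
   k, almost invariant vectors in l^2(G) would give an invariant mean on G
   (Kesten). So full and reduced norms differ, and J is the set where the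
   reduced norm, extended to the full crossed product, vanishes. It meets C(X)
   in 0 because the reduced norm is a norm on C_c(G, C(X)); it is not 0 because
   a C*-algebra carries only one C*-norm. The functional calculus needed for the
   last fact reduces to square roots of 1 - z for self-adjoint z with |z| <= 1. *)

Set Implicit Arguments.
Unset Strict Implicit.
Unset Printing Implicit Defensive.

Import Order.TTheory GRing.Theory Num.Theory.
Import numFieldNormedType.Exports.

Local Open Scope classical_set_scope.
Local Open Scope ring_scope.
Local Notation "x %:C" := (real_complex _ x) : ring_scope.

(** * C*-seminorms *)

(** Freeness at every point and an invariant state pull against each other: the full shift carries
    an invariant measure but has fixed points. The relation [z_s(t s) = z_s(t) + 1] leaves [s]
    without fixed points, yet on each left coset of the subgroup generated by [s] it still allows
    [n_s] colourings, permuted simply transitively by the rotations. So the space is a principal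
    homogeneous space of a product of finite cyclic groups, [G] acts on it by affine maps, and the
    invariant state is Haar measure; commuting finite averages take the place of integration.
    Representations enter only through seminorms on the star-algebra itself: a positive functional
    gives the seminorm of left multiplication for its form, and no Hilbert space is formed. This is
    possible because [C_c(G, C(X))] is spanned by unitaries, so that each element is bounded with
    one constant for all functionals and all C*-seminorms. For the same reason the full norm is a
    finite supremum. *)

Section RealModulus.
Context {R : realType}.
Implicit Types (z w : R[i]) (r : R).

(** The modulus with values in [R]: the order of [R[i]] is partial, while the seminorms below need
    suprema, infima and limits. *)
Definition cabs z : R := complex.Re `|z|.

Lemma cabsE z : (cabs z)%:C = `|z|.
Proof. by rewrite RRe_real// ger0_real. Qed.

Lemma cabs_ge0 z : 0 <= cabs z.
Proof. by rewrite -ler0c cabsE. Qed.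

Lemma cabsD z w : cabs (z + w) <= cabs z + cabs w.
Proof. by rewrite -lecR rmorphD/= !cabsE ler_normD. Qed.

Lemma cabsM z w : cabs (z * w) = cabs z * cabs w.
Proof. by apply: complexI; rewrite rmorphM/= !cabsE normrM. Qed.

Lemma cabsN z : cabs (- z) = cabs z.
Proof. by rewrite /cabs normrN. Qed.

Lemma cabs_real r : cabs r%:C = `|r|.
Proof.
rewrite /cabs; have [r0|r0] := leP 0 r.
  by rewrite ger0_norm ?ler0c//= ger0_norm.
by rewrite ler0_norm -?(rmorph0 (real_complex R)) ?lecR ?ltW//= ltr0_norm.
Qed.

Lemma cabs0 : cabs 0 = 0.
Proof. by rewrite /cabs normr0. Qed.

Lemma cabs1 : cabs 1 = 1.
Proof. by rewrite /cabs normr1. Qed.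

Lemma cabs_eq0 z : cabs z = 0 -> z = 0.
Proof. by move=> z0; apply/eqP; rewrite -normr_eq0 -cabsE z0. Qed.

Lemma cabs_conj z : cabs z^* = cabs z.
Proof. by rewrite /cabs norm_conjC. Qed.

Lemma cabs_sq z : ((cabs z) ^+ 2)%:C = z^* * z.
Proof. by rewrite rmorphXn/= cabsE normCK mulrC. Qed.

Lemma Re_le_cabs z : `|complex.Re z| <= cabs z.
Proof. by rewrite -lecR cabsE normc_ge_Re. Qed.

Lemma conjC_real_complex r : (r%:C)^* = r%:C.
Proof. by rewrite conj_Creal// complex_real. Qed.

Lemma ltr0_complex r : (0 < r%:C) = (0 < r).
Proof. by rewrite -(rmorph0 (real_complex R)) ltcR. Qed.

Lemma cabs_im : cabs 'i = 1.
Proof. by rewrite /cabs normCi. Qed.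

Lemma complex_pos_exists (e : R[i]) : 0 < e -> exists2 r : R, 0 < r & e = r%:C.
Proof.
move=> e0; have := e0; rewrite -(RRe_real (gtr0_real e0)) ltcR => r0.
by exists (complex.Re e).
Qed.

End RealModulus.

Section Seminorms.
Context {R : realType} {A : starAlgType R[i]}.
Implicit Types (p q : A -> R) (x y z a b c u : A).

Definition cstar_seminorm p : Prop :=
  [/\ forall x, 0 <= p x,
      forall x y, p (x + y) <= p x + p y,
      forall k x, p (k *: x) = cabs k * p x,
      forall x y, p (x * y) <= p x * p y &
      forall x, p (star x * x) = p x ^+ 2].

Lemma star0 : star (0 : A) = 0.
Proof. by rewrite -[X in star X](scale0r (0 : A)) starZ conjC0 scale0r. Qed.

Lemma starN x : star (- x) = - star x.
Proof. by rewrite -scaleN1r starZ rmorphN rmorph1 scaleN1r. Qed.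

Lemma starB x y : star (x - y) = star x - star y.
Proof. by rewrite starD starN. Qed.

Lemma star1 : star (1 : A) = 1.
Proof. by rewrite -[LHS]mulr1 -[X in _ * X = _](@starK _ A) -starM mulr1 starK. Qed.

Lemma star_sum (I : Type) (r : seq I) (F : I -> A) :
  star (\sum_(i <- r) F i) = \sum_(i <- r) star (F i).
Proof. exact: (big_morph _ (@starD _ A) star0). Qed.

Section Theory.
Context (p : A -> R) (hp : cstar_seminorm p).

Lemma csn_ge0 x : 0 <= p x. Proof. by case: hp. Qed.
Lemma csnD x y : p (x + y) <= p x + p y. Proof. by case: hp. Qed.
Lemma csnZ k x : p (k *: x) = cabs k * p x. Proof. by case: hp. Qed.
Lemma csnM x y : p (x * y) <= p x * p y. Proof. by case: hp. Qed.
Lemma csnC x : p (star x * x) = p x ^+ 2. Proof. by case: hp. Qed.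

Lemma csn0 : p 0 = 0.
Proof. by rewrite -(scale0r (0 : A)) csnZ cabs0 mul0r. Qed.

Lemma csnN x : p (- x) = p x.
Proof. by rewrite -scaleN1r csnZ cabsN cabs1 mul1r. Qed.

Lemma csn_subC x y : p (x - y) = p (y - x).
Proof. by rewrite -csnN opprB. Qed.

Lemma csnB x y : p (x - y) <= p x + p y.
Proof. by rewrite -[p y]csnN csnD. Qed.

Lemma csn_sub_trans y x z : p (x - z) <= p (x - y) + p (y - z).
Proof. by apply: le_trans (csnD _ _); rewrite addrA subrK. Qed.

Lemma csn_dist x y : `|p x - p y| <= p (x - y).
Proof.
have le a b : p a - p b <= p (a - b) by rewrite lerBlDr -[in leLHS](subrK b a) csnD.
by rewrite ler_norml le andbT lerNl opprB csn_subC le.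
Qed.

Lemma csn_star x : p (star x) = p x.
Proof.
have le y : p y <= p (star y).
  have [y0|] := eqVneq (p y) 0; first by rewrite y0 csn_ge0.
  move=> y0; have yp : 0 < p y by rewrite lt_def y0 csn_ge0.
  by rewrite -(ler_pM2r yp) -expr2 -csnC csnM.
by apply/eqP; rewrite eq_le -{2}[x]starK !le.
Qed.

(** [p 1] equals its own square, so it is 0 or 1; the value 0 belongs to the zero seminorm. *)
Lemma csn1 : p 1 <= 1.
Proof.
have := csnC 1; rewrite star1 mulr1 expr2 => h.
have [->//|p1] := eqVneq (p 1) 0.
by rewrite -[leRHS](mulfK p1) mul1r {2}h mulfK.
Qed.

Lemma csnX2 x : star x = x -> p (x * x) = p x ^+ 2.
Proof. by move=> xs; rewrite -csnC xs. Qed.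

(* [u = a + i c] satisfies [u^* u = l^2], and [a = (u + u^* ) / 2]. *)
Lemma csn_circle a c (l : R) : star a = a -> star c = c -> a * c = c * a ->
  0 <= l -> a * a + c * c = (l ^+ 2)%:C *: 1 -> p a <= l.
Proof.
move=> as_ cs ac l0 h; pose u := a + 'i *: c.
have us : star u = a - 'i *: c by rewrite starD starZ as_ cs conjCi scaleNr.
have uu : star u * u = (l ^+ 2)%:C *: 1.
  rewrite us mulrDl !mulrDr -h !mulNr -?scalerAr -!scalerAl -?scalerAr ac.
  rewrite scalerA -(expr2 'i) sqrCi scaleN1r opprK.
  by rewrite addrA -(addrA (a * a)) subrr addr0.
have pu : p u <= l.
  rewrite -(@ler_pXn2r _ 2)// ?nnegrE ?csn_ge0// -csnC uu csnZ cabs_real.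
  by rewrite ger0_norm ?sqr_ge0// ler_piMr ?sqr_ge0 ?csn1.
have -> : a = (2^-1)%:C *: (u + star u).
  rewrite us addrACA subrr addr0 -mulr2n -(scaler_nat 2 a) scalerA.
  by rewrite fmorphV rmorph_nat mulVf ?scale1r// pnatr_eq0.
rewrite csnZ cabs_real ger0_norm ?invr_ge0// mulrC ler_pdivrMr//.
by rewrite (le_trans (csnD _ _))// csn_star -[2]/(1 + 1) mulrDr mulr1 lerD.
Qed.

End Theory.

End Seminorms.

Section SupSeminorm.
Context {R : realType} {A : starAlgType R[i]}.
Implicit Types (p : A -> R) (x y : A).

Definition sup_seminorm (S : set (A -> R)) x : R := sup [set p x | p in S].

Context (S : set (A -> R)) (S0 : S !=set0)
  (Scsn : forall p, S p -> cstar_seminorm p)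
  (Sbnd : forall x, exists K, forall p, S p -> p x <= K).

Lemma sup_seminorm_ge p x : S p -> p x <= sup_seminorm S x.
Proof.
move=> Sp; apply: ub_le_sup; last by exists p.
by have [K KP] := Sbnd x; exists K => _ [q Sq <-]; exact: KP.
Qed.

Lemma sup_seminorm_le x K : (forall p, S p -> p x <= K) -> sup_seminorm S x <= K.
Proof.
move=> h; apply: ge_sup; first by have [p Sp] := S0; exists (p x); exists p.
by move=> _ [p Sp <-]; exact: h.
Qed.

Lemma sup_seminorm_csn : cstar_seminorm (sup_seminorm S).
Proof.
have ge0 x : 0 <= sup_seminorm S x.
  have [p Sp] := S0; apply: le_trans (sup_seminorm_ge x Sp).
  exact: csn_ge0 (Scsn Sp) x.
have Zle k x : sup_seminorm S (k *: x) <= cabs k * sup_seminorm S x.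
  apply: sup_seminorm_le => p Sp; rewrite (csnZ (Scsn Sp)) ler_wpM2l ?cabs_ge0//.
  exact: sup_seminorm_ge.
split=> //.
- move=> x y; apply: sup_seminorm_le => p Sp.
  by rewrite (le_trans (csnD (Scsn Sp) _ _))// lerD ?sup_seminorm_ge.
- move=> k x; apply/eqP; rewrite eq_le Zle/=.
  have [->|k0] := eqVneq k 0; first by rewrite cabs0 mul0r.
  rewrite -{1}(scale1r x) -(mulVf k0) -scalerA.
  have kp : 0 < cabs k.
    by rewrite lt_def cabs_ge0 andbT; apply: contra k0 => /eqP/cabs_eq0 ->.
  rewrite (le_trans (ler_wpM2l (ltW kp) (Zle _ _)))// mulrA -cabsM divff//.
  by rewrite cabs1 mul1r.
- move=> x y; apply: sup_seminorm_le => p Sp.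
  rewrite (le_trans (csnM (Scsn Sp) _ _))// ler_pM ?sup_seminorm_ge//;
    exact: csn_ge0 (Scsn Sp) _.
- move=> x; apply/eqP; rewrite eq_le; apply/andP; split.
    apply: sup_seminorm_le => p Sp; rewrite (csnC (Scsn Sp)).
    by rewrite ler_pXn2r ?nnegrE ?sup_seminorm_ge//; exact: csn_ge0 (Scsn Sp) _.
  (* For the reverse inequality, each [p x] is at most the square root of the supremum at
     [x^* x]. *)
  have s0 : 0 <= Num.sqrt (sup_seminorm S (star x * x)) by exact: sqrtr_ge0.
  rewrite -[leRHS]sqr_sqrtr// ler_pXn2r ?nnegrE//.
  apply: sup_seminorm_le => p Sp.
  rewrite -(@ler_pXn2r _ 2)// ?nnegrE ?(csn_ge0 (Scsn Sp))// sqr_sqrtr//.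
  by rewrite -(csnC (Scsn Sp)) sup_seminorm_ge.
Qed.

End SupSeminorm.

(** * Uniform bounds obtained from unitaries *)

Section UnitaryBound.
Context {R : realType} {A : starAlgType R[i]}.
Implicit Types (a b c x u : A) (nu : A -> R).

(** The common ground of C*-seminorms and of the vector norms given by positive functionals. *)
Definition unitary_seminorm nu : Prop :=
  [/\ forall x, 0 <= nu x,
      forall x y, nu (x + y) <= nu x + nu y,
      forall k x, nu (k *: x) = cabs k * nu x &
      forall u x, star u * u = 1 -> nu (u * x) = nu x].

(** The constant is chosen before [nu]. For C*-seminorms and [c = 1] it bounds all of them at [a] at
    once, which makes the full norm finite; for a vector norm it makes left multiplication by [a] a
    bounded operator. *)
Definition unitary_bounded a : Prop :=
  exists2 K : R, 0 <= K &
    forall nu, unitary_seminorm nu -> forall c, nu (a * c) <= K * nu c.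

Lemma unitary_bounded_unitary u : star u * u = 1 -> unitary_bounded u.
Proof.
by move=> u1; exists 1 => // nu [_ _ _ nuU] c; rewrite nuU// mul1r.
Qed.

Lemma unitary_bounded0 : unitary_bounded 0.
Proof.
exists 0 => // nu [_ _ nuZ _] c; rewrite mul0r.
by rewrite mul0r -(scale0r (0 : A)) nuZ cabs0 mul0r.
Qed.

Lemma unitary_boundedD a b :
  unitary_bounded a -> unitary_bounded b -> unitary_bounded (a + b).
Proof.
move=> [K K0 Ka] [L L0 Lb]; exists (K + L); first exact: addr_ge0.
move=> nu nuP c; rewrite !mulrDl; have [_ nuD _ _] := nuP.
by rewrite (le_trans (nuD _ _))// lerD ?Ka ?Lb.
Qed.

Lemma unitary_boundedZ k a : unitary_bounded a -> unitary_bounded (k *: a).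
Proof.
move=> [K K0 Ka]; exists (cabs k * K); first by rewrite mulr_ge0 ?cabs_ge0.
move=> nu nuP c; have [_ _ nuZ _] := nuP.
by rewrite -scalerAl nuZ -mulrA ler_wpM2l ?cabs_ge0 ?Ka.
Qed.

Lemma unitary_bounded_sum (I : Type) (r : seq I) (F : I -> A) :
  (forall i, unitary_bounded (F i)) -> unitary_bounded (\sum_(i <- r) F i).
Proof.
move=> h; elim/big_rec : _ => [|i x _]; first exact: unitary_bounded0.
exact: unitary_boundedD.
Qed.

Lemma csn_unitary_seminorm p : cstar_seminorm p -> unitary_seminorm p.
Proof.
move=> hp; have [p0 pD pZ _ _] := hp; split=> // u x u1.
apply/eqP; rewrite -(@eqrXn2 _ 2)//; apply/eqP.
by rewrite -!(csnC hp) starM mulrA -(mulrA (star x)) u1 mulr1.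
Qed.

Lemma unitary_bounded_csn a : unitary_bounded a ->
  exists K, forall p, cstar_seminorm p -> p a <= K.
Proof.
move=> [K K0 Ka]; exists K => p hp.
have := Ka _ (csn_unitary_seminorm hp) 1; rewrite mulr1 => /le_trans; apply.
by rewrite ler_piMr// csn1.
Qed.

End UnitaryBound.

(** * The operator seminorm of a positive functional *)

Section GNS.
Context {R : realType} {A : starAlgType R[i]}.
Implicit Types (a b c x u : A).

Definition positive_functional (phi : A -> R[i]) : Prop :=
  [/\ forall x y, phi (x + y) = phi x + phi y,
      forall k x, phi (k *: x) = k * phi x,
      forall x, phi (star x) = (phi x)^* &
      forall x, 0 <= phi (star x * x)].

Context (phi : A -> R[i]) (hphi : positive_functional phi)
  (hbnd : forall a, unitary_bounded a).

Let sq b : R := complex.Re (phi (star b * b)).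

(** The norm of the vector represented by [b] in the GNS space of [phi]. Null vectors are not
    divided out. *)
Definition gns_vnorm b : R := Num.sqrt (sq b).

Let sqE b : (sq b)%:C = phi (star b * b).
Proof. by rewrite RRe_real// ger0_real//; have [_ _ _] := hphi; apply. Qed.

Let sq_ge0 b : 0 <= sq b.
Proof. by rewrite -ler0c sqE; have [_ _ _] := hphi; apply. Qed.

Let ReD (z w : R[i]) : complex.Re (z + w) = complex.Re z + complex.Re w.
Proof. by case: z w => [? ?] [? ?]. Qed.

Let ReC (z : R[i]) : complex.Re z^* = complex.Re z.
Proof. by case: z => [? ?]. Qed.

Let ReM (r : R) (z : R[i]) : complex.Re (r%:C * z) = r * complex.Re z.
Proof. by case: z => [? ?] /=; rewrite mul0r subr0. Qed.

Let sqD a b : sq (a + b) = sq a + sq b + 2 * complex.Re (phi (star a * b)).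
Proof.
have [pD pZ ps _] := hphi.
rewrite /sq starD !mulrDl !mulrDr !pD !ReD.
have -> : star b * a = star (star a * b) by rewrite starM starK.
by rewrite ps ReC; ring.
Qed.

Let sqZ k a : sq (k *: a) = cabs k ^+ 2 * sq a.
Proof.
have [_ pZ _ _] := hphi.
by rewrite /sq starZ -scalerAl -scalerAr scalerA pZ -cabs_sq ReM.
Qed.

(** Positivity at the vector [a - t s^* b]: the factor [s^*] makes the cross term real, so a
    quadratic polynomial in the real variable [t] remains. *)
Let cauchy_schwarz a b : cabs (phi (star a * b)) ^+ 2 <= sq a * sq b.
Proof.
have [_ pZ ps _] := hphi.
set s := phi _; set n := cabs s ^+ 2.
have key (t : R) : 0 <= sq a - 2 * t * n + t ^+ 2 * n * sq b.
  have := sq_ge0 (a + (- t%:C * s^*) *: b).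
  rewrite sqD sqZ cabsM cabsN cabs_real cabs_conj -scalerAr pZ -/s.
  rewrite exprMn real_normK ?num_real// -(mulrA _ s^*) -cabs_sq -/n -rmorphN.
  rewrite -rmorphM/=.
  by move=> h; apply: le_trans h _; rewrite le_eqVlt; apply/orP; left; apply/eqP; ring.
have n0 : 0 <= n by exact: sqr_ge0.
have [b0|b0] := eqVneq (sq b) 0.
  rewrite b0 mulr0 leNgt; apply/negP => np.
  (* At this [t] the inequality would read [0 <= - sq a - 2]. *)
  have := key ((sq a + 1) / n); rewrite b0 mulr0 addr0 -mulrA.
  by rewrite divfK ?gt_eqF//; have := sq_ge0 a; lra.
have bp : 0 < sq b by rewrite lt_def b0 sq_ge0.
have := key (sq b)^-1.
have -> : sq a - 2 * (sq b)^-1 * n + (sq b)^-1 ^+ 2 * n * sq b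
   = sq a - n / sq b by field.
by rewrite subr_ge0 ler_pdivrMr.
Qed.

Lemma gns_vnorm_ge0 b : 0 <= gns_vnorm b.
Proof. exact: sqrtr_ge0. Qed.

Lemma gns_vnorm_sq b : gns_vnorm b ^+ 2 = complex.Re (phi (star b * b)).
Proof. by rewrite sqr_sqrtr. Qed.

Let cs a b : cabs (phi (star a * b)) <= gns_vnorm a * gns_vnorm b.
Proof.
rewrite -(@ler_pXn2r _ 2)// ?nnegrE ?cabs_ge0 ?mulr_ge0 ?gns_vnorm_ge0//.
by rewrite exprMn !gns_vnorm_sq cauchy_schwarz.
Qed.

Lemma gns_vnorm_parallelogram a b :
  gns_vnorm (a + b) ^+ 2 + gns_vnorm (a - b) ^+ 2 =
  2 * gns_vnorm a ^+ 2 + 2 * gns_vnorm b ^+ 2.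
Proof.
rewrite !gns_vnorm_sq -!/(sq _) !sqD -scaleN1r sqZ cabsN cabs1 expr1n mul1r.
have [_ pZ _ _] := hphi.
rewrite -scalerAr pZ; have -> : -1 = (-1)%:C :> R[i] by rewrite rmorphN rmorph1.
by rewrite ReM; ring.
Qed.

Lemma gns_vnorm_seminorm : unitary_seminorm gns_vnorm.
Proof.
split; first exact: gns_vnorm_ge0.
- move=> x y; rewrite -(@ler_pXn2r _ 2)// ?nnegrE ?addr_ge0 ?gns_vnorm_ge0//.
  have := le_trans (le_trans (ler_norm _) (Re_le_cabs _)) (cs x y).
  by rewrite sqrrD !gns_vnorm_sq -!/(sq _) sqD; lra.
- move=> k x; rewrite /gns_vnorm sqZ sqrtrM ?sqr_ge0// sqrtr_sqr.
  by rewrite ger0_norm ?cabs_ge0.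
- move=> u x u1; rewrite /gns_vnorm /sq starM.
  by rewrite mulrA -(mulrA (star x)) u1 mulr1.
Qed.

Let bset a := [set K : R | 0 <= K /\ forall c, gns_vnorm (a * c) <= K * gns_vnorm c].

(** The operator norm of left multiplication by [a], as an infimum of constants, because quotients
    by the norm of [c] are meaningless for null vectors [c]. *)
Definition gns_seminorm a : R := inf (bset a).

Let bset0 a : bset a !=set0.
Proof.
by have [K K0 KP] := hbnd a; exists K; split=> // c; apply/KP/gns_vnorm_seminorm.
Qed.

Lemma gns_seminorm_ge0 a : 0 <= gns_seminorm a.
Proof. by apply: lb_le_inf => // K []. Qed.

Lemma gns_seminorm_le a K : 0 <= K ->
  (forall c, gns_vnorm (a * c) <= K * gns_vnorm c) -> gns_seminorm a <= K.
Proof. by move=> K0 KP; apply: ge_inf; [exists 0 => ? []|split]. Qed.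

Lemma gns_vnormM a c : gns_vnorm (a * c) <= gns_seminorm a * gns_vnorm c.
Proof.
have [c0|c0] := eqVneq (gns_vnorm c) 0.
  by have [K [_ /(_ c)]] := bset0 a; rewrite c0 !mulr0.
have cp : 0 < gns_vnorm c by rewrite lt_def c0 gns_vnorm_ge0.
rewrite -ler_pdivrMr//; apply: lb_le_inf => // K [_ KP].
by rewrite ler_pdivrMr.
Qed.

Lemma gns_seminorm_csn : cstar_seminorm gns_seminorm.
Proof.
have [n0 nD nZ _] := gns_vnorm_seminorm.
have N0 := gns_seminorm_ge0.
have Zle k x : gns_seminorm (k *: x) <= cabs k * gns_seminorm x.
  apply: gns_seminorm_le => [|c]; first by rewrite mulr_ge0 ?cabs_ge0.
  by rewrite -scalerAl nZ -mulrA ler_wpM2l ?cabs_ge0 ?gns_vnormM.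
have Mle x y : gns_seminorm (x * y) <= gns_seminorm x * gns_seminorm y.
  apply: gns_seminorm_le => [|c]; first exact: mulr_ge0.
  rewrite -mulrA (le_trans (gns_vnormM _ _))// -mulrA ler_wpM2l ?gns_vnormM//.
have Cge x : gns_seminorm x ^+ 2 <= gns_seminorm (star x * x).
  rewrite -[leRHS]sqr_sqrtr// ler_pXn2r ?nnegrE ?sqrtr_ge0//.
  apply: gns_seminorm_le => [|c]; first exact: sqrtr_ge0.
  rewrite -(@ler_pXn2r _ 2)// ?nnegrE ?mulr_ge0 ?sqrtr_ge0// exprMn.
  rewrite [X in _ <= X * _]sqr_sqrtr// gns_vnorm_sq starM -mulrA.
  rewrite (le_trans (ler_norm _))// (le_trans (Re_le_cabs _))//.
  rewrite (le_trans (cs _ _))// mulrA.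
  by rewrite (le_trans (ler_wpM2l (n0 c) (gns_vnormM _ _)))// expr2 mulrCA.
have sle x : gns_seminorm x <= gns_seminorm (star x).
  have [x0|x0] := eqVneq (gns_seminorm x) 0; first by rewrite x0.
  have xp : 0 < gns_seminorm x by rewrite lt_def x0 N0.
  by rewrite -(ler_pM2r xp) -expr2 (le_trans (Cge x)).
split=> //.
- move=> x y; apply: gns_seminorm_le => [|c]; first exact: addr_ge0.
  by rewrite !mulrDl (le_trans (nD _ _))// lerD ?gns_vnormM.
- move=> k x; apply/eqP; rewrite eq_le Zle/=.
  have [->|k0] := eqVneq k 0; first by rewrite cabs0 mul0r.
  rewrite -{1}(scale1r x) -(mulVf k0) -scalerA.
  have kp : 0 < cabs k.
    by rewrite lt_def cabs_ge0 andbT; apply: contra k0 => /eqP/cabs_eq0 ->.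
  rewrite (le_trans (ler_wpM2l (ltW kp) (Zle _ _)))// mulrA -cabsM divff//.
  by rewrite cabs1 mul1r.
- move=> x; apply/eqP; rewrite eq_le Cge andbT (le_trans (Mle _ _))//.
  by rewrite expr2 ler_wpM2r// -{2}(starK x) sle.
Qed.

End GNS.

(** * Uniqueness of the C*-norm *)

Section Limits.
Context {R : realType}.

Lemma cvg0_le (f g : nat -> R) : (forall n, 0 <= f n <= g n) ->
  g @ \oo --> 0 -> f @ \oo --> 0.
Proof.
by move=> fg g0; apply: (squeeze_cvgr _ (@cvg_cst _ (0:R) _ _ _) g0); apply: nearW.
Qed.

Context {A : starAlgType R[i]}.
Implicit Types (p : A -> R) (u v : nat -> A) (x y l m : A).

Definition tends p u l := (fun n => p (u n - l)) @ \oo --> (0 : R).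

Definition cauchy_for p u :=
  forall e : R, 0 < e -> exists N, forall i j, (N <= i)%N -> (N <= j)%N ->
    p (u i - u j) < e.

Section Theory.
Context (p : A -> R) (hp : cstar_seminorm p).

Lemma tendsP u l : tends p u l <->
  forall e : R, 0 < e -> exists N, forall n, (N <= n)%N -> p (u n - l) < e.
Proof.
split=> [/cvgrPdist_lt h e /h[N _ NP]|h].
  exists N => n /NP; rewrite /= sub0r normrN ger0_norm//; exact: csn_ge0.
apply/cvgrPdist_lt => e /h[N NP]; exists N => // n /NP /=.
by rewrite sub0r normrN ger0_norm//; exact: csn_ge0.
Qed.

Lemma tends_cst x : tends p (fun=> x) x.
Proof. by rewrite /tends; under eq_fun do rewrite subrr (csn0 hp); exact: cvg_cst. Qed.

Lemma tendsD u v l m : tends p u l -> tends p v m ->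
  tends p (fun n => u n + v n) (l + m).
Proof.
move=> ul vm; apply: (@cvg0_le _ (fun n => p (u n - l) + p (v n - m))).
  by move=> n; rewrite csn_ge0//= opprD addrACA csnD.
by rewrite -[X in _ --> X]addr0; apply: cvgD.
Qed.

Lemma tendsZ k u l : tends p u l -> tends p (fun n => k *: u n) (k *: l).
Proof.
move=> ul; rewrite /tends; under eq_fun do rewrite -scalerBr (csnZ hp).
suff : (fun n => cabs k * p (u n - l)) @ \oo --> cabs k * 0 by rewrite mulr0.
by apply: cvgM => //; exact: cvg_cst.
Qed.

Lemma tendsN u l : tends p u l -> tends p (fun n => - u n) (- l).
Proof.
by move=> ul; rewrite /tends; under eq_fun do rewrite -opprD (csnN hp).
Qed.

Lemma tends_norm u l : tends p u l -> (fun n => p (u n)) @ \oo --> p l.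
Proof.
move=> ul; apply/cvgrPdist_lt => e e0; have [N NP] := (tendsP u l).1 ul e e0.
exists N => // n /= /NP; apply: le_lt_trans.
by rewrite distrC (csn_dist hp).
Qed.

Lemma tendsM u v l m : tends p u l -> tends p v m ->
  tends p (fun n => u n * v n) (l * m).
Proof.
move=> ul vm.
apply: (@cvg0_le _ (fun n => p (u n - l) * p (v n) + p l * p (v n - m))).
  move=> n; rewrite csn_ge0//=.
  have -> : u n * v n - l * m = (u n - l) * v n + l * (v n - m).
    by rewrite mulrBl mulrBr addrA subrK.
  by rewrite (le_trans (csnD hp _ _))// lerD ?(csnM hp).
suff : (fun n => p (u n - l) * p (v n) + p l * p (v n - m)) @ \oo -->
    0 * p m + p l * 0 by rewrite mul0r mulr0 addr0.
by apply: cvgD; apply: cvgM => //; [exact: tends_norm|exact: cvg_cst].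
Qed.

Lemma tends_star u l : tends p u l -> tends p (fun n => star (u n)) (star l).
Proof.
by move=> ul; rewrite /tends; under eq_fun do rewrite -starB (csn_star hp).
Qed.

Lemma tendsS u l : tends p u l -> tends p (fun n => u n.+1) l.
Proof. by move=> ul; rewrite /tends (cvg_shiftS (fun n => p (u n - l))). Qed.

Lemma tends_le u l K : tends p u l -> (forall n, p (u n) <= K) -> p l <= K.
Proof.
by move=> /tends_norm ul uK; apply: (ler_cvg_to ul (@cvg_cst _ K nat \oo _)); apply: nearW.
Qed.

Lemma tends_uniq u l m : (forall x, p x = 0 -> x = 0) ->
  tends p u l -> tends p u m -> l = m.
Proof.
move=> p0 ul um; apply/eqP; rewrite -subr_eq0; apply/eqP/p0.
have := tendsD um (tendsN ul); rewrite /tends; under eq_fun do rewrite subrr sub0r (csnN hp).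
move=> h; have := cvg_unique _ h (@cvg_cst _ (p (m - l)) nat \oo _).
by rewrite -opprB (csnN hp) => <-.
Qed.

End Theory.
End Limits.

Section RealNorm.
Context {R : realType}.

Lemma cstar_norm_csn (A : starAlgType R[i]) (q : A -> R[i]) : cstar_norm q ->
  cstar_seminorm (fun x => complex.Re (q x)) /\
  (forall x, (complex.Re (q x))%:C = q x).
Proof.
move=> [q0 [_ [qD [qZ [qM qC]]]]].
have qE x : (complex.Re (q x))%:C = q x by rewrite RRe_real// ger0_real.
split=> //; split=> [x|x y|k x|x y|x].
- by rewrite -ler0c qE.
- by rewrite -lecR rmorphD/= !qE.
- by apply: complexI; rewrite rmorphM/= cabsE !qE.
- by rewrite -lecR rmorphM/= !qE.
- by apply: complexI; rewrite rmorphXn/= !qE.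
Qed.

Lemma csn_cstar_norm (A : starAlgType R[i]) (p : A -> R) : cstar_seminorm p ->
  (forall x, p x = 0 -> x = 0) -> cstar_norm (fun x => (p x)%:C).
Proof.
move=> hp p0; split; [|split; [|split; [|split; [|split]]]].
- by move=> x; rewrite ler0c csn_ge0.
- by move=> x /(@complexI _ _ 0)/p0.
- by move=> x y; rewrite -rmorphD lecR csnD.
- by move=> k x; rewrite csnZ// rmorphM/= cabsE.
- by move=> x y; rewrite -rmorphM lecR csnM.
- by move=> x; rewrite -rmorphXn/= csnC.
Qed.

Context {A : cstarAlgType R[i]}.
Implicit Types (x y : A).

Definition rnorm x : R := complex.Re (cnorm x).

Lemma rnormE x : (rnorm x)%:C = cnorm x.
Proof. exact: (cstar_norm_csn (@cnorm_cstar _ A)).2. Qed.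

Lemma rnorm_csn : cstar_seminorm rnorm.
Proof. exact: (cstar_norm_csn (@cnorm_cstar _ A)).1. Qed.

Lemma rnorm_eq0 x : rnorm x = 0 -> x = 0.
Proof. by move=> x0; apply: (@cnorm_cstar _ A).2.1; rewrite -rnormE x0. Qed.

Lemma rnorm_complete (u : nat -> A) :
  cauchy_for rnorm u -> exists l, tends rnorm u l.
Proof.
move=> uc; have [] := @cnorm_complete _ A u.
  move=> _ /complex_pos_exists[e e0 ->]; have [N NP] := uc e e0.
  by exists N => m n mN nN; rewrite -rnormE ltcR NP.
move=> l lP; exists l; apply/(tendsP rnorm_csn) => e e0.
have [|N NP] := lP e%:C; first by rewrite ltr0_complex.
by exists N => k /NP; rewrite -rnormE ltcR.
Qed.

End RealNorm.

(** * Square roots of self-adjoint elements *)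

Section SquareRoot.
Context {R : realType} {A : cstarAlgType R[i]}.
Implicit Types (x y z b c : A).

Local Notation half := ((2^-1 : R)%:C).

Let half2 : half + half = 1 :> R[i].
Proof. by rewrite -rmorphD -div1r -splitr. Qed.

(* [1 - s] is the limit of the iteration [w -> (z + w^2) / 2]; its increments
   are dominated by those of the scalar iteration with [z = 1], which increases
   and is bounded by 1. *)
Lemma cstar_sqrt z : star z = z -> rnorm z <= 1 ->
  exists s, [/\ star s = s, s * s = 1 - z,
    forall y, GRing.comm y z -> GRing.comm y s & rnorm (1 - s) <= 1].
Proof.
move=> zs z1; have hp := @rnorm_csn R A.
pose t := fix t n : R := if n is n'.+1 then (1 + t n' ^+ 2) / 2 else 0.
pose w := fix w n : A := if n is n'.+1 then half *: (z + w n' * w n') else 0.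
have t01 n : 0 <= t n <= 1.
  by elim: n => [|n /andP[? ?]] /=; [rewrite lexx ler01|apply/andP; split; nra].
have ti n : t n <= t n.+1.
  by have /andP[? ?] := t01 n; rewrite /=; have := sqr_ge0 (t n - 1); nra.
have ws n : star (w n) = w n.
  elim: n => [|n IH] /=; first exact: star0.
  by rewrite starZ starD starM zs IH conjC_real_complex.
have wc n y : GRing.comm y z -> GRing.comm y (w n).
  move=> yz; elim: n => [|n IH] /=; first exact: commr0.
  rewrite /GRing.comm -scalerAr -scalerAl; congr (_ *: _).
  by apply: commrD => //; apply: commrM.
have ww n m : GRing.comm (w n) (w m) by apply/wc/commr_sym/wc.
have halfn x : rnorm (half *: x) = rnorm x / 2.
  by rewrite (csnZ hp) cabs_real ger0_norm ?invr_ge0// mulrC.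
have wt n : rnorm (w n) <= t n.
  elim: n => [|n IH] /=; first by rewrite (csn0 hp).
  rewrite halfn ler_pM2r// (le_trans (csnD hp _ _))// lerD//.
  by rewrite (csnX2 hp)// ler_pXn2r ?nnegrE ?(csn_ge0 hp)//; case/andP: (t01 n).
have wd n : rnorm (w n.+1 - w n) <= t n.+1 - t n.
  elim: n => [|n IH].
    rewrite [w 0]/= subr0 [t 0]/= subr0; exact: wt.
  have -> : w n.+2 - w n.+1 = half *: ((w n.+1 - w n) * (w n.+1 + w n)).
    rewrite -[w n.+2]/(half *: (z + w n.+1 * w n.+1)).
    rewrite -[X in _ - X]/(half *: (z + w n * w n)) -scalerBr; congr (_ *: _).
    rewrite opprD addrACA subrr add0r mulrBl !mulrDr (ww n.+1 n) opprD addrA.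
    by rewrite addrK.
  rewrite halfn; have -> : t n.+2 - t n.+1 = (t n.+1 - t n) * (t n.+1 + t n) / 2.
    have : t n.+1 = (1 + t n ^+ 2) / 2 by [].
    by rewrite -[t n.+2]/((1 + t n.+1 ^+ 2) / 2); move: (t n.+1) (t n) => *; lra.
  rewrite ler_pM2r// (le_trans (csnM hp _ _))// ler_pM ?(csn_ge0 hp)//.
  by rewrite (le_trans (csnD hp _ _))// lerD.
have wdm n k : rnorm (w (n + k)%N - w n) <= t (n + k)%N - t n.
  elim: k => [|k IH]; first by rewrite addn0 !subrr (csn0 hp).
  rewrite addnS (le_trans (csn_sub_trans hp (w (n + k)%N) _ _))//.
  by have := wd (n + k)%N; lra.
have tmono m n : (m <= n)%N -> t m <= t n.
  by move=> /subnKC <-; elim: (n - m)%N => [|k IH]; rewrite ?addn0// addnS (le_trans IH).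
have [l ul] : exists l, tends rnorm w l.
  apply: rnorm_complete => e e0.
  pose T := [set t n | n in [set: nat]].
  have hT : has_sup T.
    by split; [exists (t 0); exists 0%N|exists 1 => _ [n _ <-]; case/andP: (t01 n)].
  have [_ [N _ <-] tN] := sup_adherent e0 hT.
  have main i j : (N <= i)%N -> (i <= j)%N -> rnorm (w j - w i) < e.
    move=> Ni ij; rewrite -(subnKC ij).
    apply: le_lt_trans (wdm _ _) _; rewrite subnKC//.
    have : t j <= sup T by apply: ub_le_sup; [exact: hT.2|exists j].
    by have := tmono _ _ Ni; lra.
  exists N => i j Ni Nj; have [ij|/ltnW ji] := leqP i j; last exact: main.
  by rewrite (csn_subC hp) main.
have lu := tends_uniq hp (@rnorm_eq0 R A).
have ls : star l = l.
  apply: (lu w _ _ _ ul); have := tends_star hp ul.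
  by rewrite (_ : (fun n => star (w n)) = w)//; apply/funext.
have lw : l = half *: (z + l * l).
  apply: (lu _ _ _ (tendsS ul)); apply: tendsZ => //; apply: tendsD => //.
    exact: tends_cst.
  exact: tendsM.
have l2 : l + l = z + l * l by rewrite {1 2}lw -scalerDl half2 scale1r.
exists (1 - l); split.
- by rewrite starB star1 ls.
- have -> : z = l + l - l * l by rewrite l2 addrK.
  rewrite mulrBl mul1r mulrBr mulr1 !opprB -addrA; congr (_ + _).
  by rewrite opprD addrCA.
- move=> y yz; rewrite /GRing.comm mulrBr mulrBl mulr1 mul1r; congr (_ - _).
  apply: (@lu (fun n => y * w n)).
    by apply: tendsM => //; exact: tends_cst.
  rewrite (_ : (fun n => y * w n) = fun n => w n * y); last first.
    by apply/funext => n; exact: wc.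
  by apply: tendsM => //; exact: tends_cst.
- rewrite opprB addrCA subrr addr0; apply: (tends_le hp ul) => n.
  by rewrite (le_trans (wt n))//; case/andP: (t01 n).
Qed.

(** [c] is [sqrt (1 - b^2)]. That it commutes with whatever commutes with [b] replaces its being a
    limit of polynomials in [b]. *)
Lemma cstar_circle b : star b = b -> rnorm b <= 1 ->
  exists c, [/\ star c = c, b * b + c * c = 1,
    forall y, GRing.comm y b -> GRing.comm y c & rnorm c <= 1].
Proof.
have hp := @rnorm_csn R A.
move=> bs b1; have [||c [cs cc ccomm _]] := @cstar_sqrt (b * b).
- by rewrite starM bs.
- by rewrite (csnX2 hp)// expr_le1// (csn_ge0 hp).
have bc : b * c = c * b by apply: ccomm; exact: commrM.
have h1 : b * b + c * c = 1 by rewrite cc addrC subrK.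
exists c; split=> //.
  by move=> y yb; apply: ccomm; exact: commrM.
apply: (@csn_circle _ _ _ hp c b 1) => //.
by rewrite expr1n scale1r addrC.
Qed.

(** [h] is the square root of [|b|]. Only roots of [1 - z] are available, so three are taken:
    [c = sqrt (1 - b^2)], then [g = sqrt (1 - c^2) = |b|], then [h = sqrt (1 - (1 - g))]. The last
    is allowed by the bound on [1 - s] in [cstar_sqrt]. *)
Lemma cstar_abs b : star b = b -> rnorm b <= 1 ->
  exists h, [/\ star h = h, (h * h) * (h * h) = b * b &
    forall y, GRing.comm y b -> GRing.comm y h].
Proof.
move=> bs b1; have [c [cs bc ccomm c1]] := cstar_circle bs b1.
have hp := @rnorm_csn R A.
have [||g [gs gg gcomm g1]] := @cstar_sqrt (c * c).
- by rewrite starM cs.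
- by rewrite (csnX2 hp)// expr_le1// (csn_ge0 hp).
have [||h [hs hh hcomm _]] := @cstar_sqrt (1 - g) => //.
  by rewrite starB star1 gs.
exists h; split=> // [|y yb].
  by rewrite hh subKr gg -bc addrK.
apply: hcomm; apply: commrB; first exact: commr1.
by apply: gcomm; apply: commrM; exact: ccomm.
Qed.

End SquareRoot.

(** * Injective star-morphisms of C*-algebras are isometric *)

Section Isometry.
Context {R : realType} {A B : cstarAlgType R[i]} (phi : {lrmorphism A -> B}).
Context (phi_star : {morph phi : x / star x})
        (phi_inj : forall x, phi x = 0 -> x = 0).

Let hA := @rnorm_csn R A.
Let hB := @rnorm_csn R B.

(* If [phi] shrank the norm of a self-adjoint [x] with [rnorm x = 1] to at most
   [l < 1], then [|b| + b] for [b = (x^2 - l^2) / 4] would be a nonzero element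
   of the kernel. *)
Let isometry_sa (x : A) (l : R) : star x = x -> 0 < l < 1 ->
  rnorm x = 1 -> rnorm (phi x) <= l -> False.
Proof.
move=> xs /andP[l0 l1] x1 phixl.
have rc := @conjC_real_complex R.
(* The factor 1/4 makes [rnorm b <= 1], and turns [- 4 b = l^2 - x^2] into the square of [2 h] once
   [h^2 = - b] is known. *)
pose b : A := (4^-1)%:C *: (x * x - (l ^+ 2)%:C *: 1).
have bs : star b = b by rewrite starZ starB starM xs starZ star1 !rc.
have b1 : rnorm b <= 1.
  rewrite (csnZ hA) cabs_real ger0_norm ?invr_ge0// mulrC ler_pdivrMr// mul1r.
  rewrite (le_trans (csnB hA _ _))// (csnX2 hA)// x1 (csnZ hA) cabs_real.
  have := csn1 hA; have := csn_ge0 hA 1; rewrite ger0_norm ?sqr_ge0//; nra.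
have [h [hs hh hcomm]] := cstar_abs bs b1.
have xb : GRing.comm x b.
  rewrite /GRing.comm -scalerAr -scalerAl; congr (_ *: _).
  by rewrite mulrBr mulrBl mulrA -scalerAr -scalerAl mulr1 mul1r.
have hx : GRing.comm x h by exact: hcomm.
(* Since [rnorm (phi x) <= l], the element [- phi b] is the square of the self-adjoint
   [e = (l / 2) d]. *)
have [d [ds dd dcomm _]] : exists d : B, [/\ star d = d,
    (l^-1%:C *: phi x) * (l^-1%:C *: phi x) + d * d = 1,
    forall y, GRing.comm y (l^-1%:C *: phi x) -> GRing.comm y d &
    rnorm d <= 1].
  apply: cstar_circle; first by rewrite starZ rc -phi_star xs.
  rewrite (csnZ hB) cabs_real ger0_norm ?invr_ge0 ?(ltW l0)//.
  by rewrite mulrC ler_pdivrMr// mul1r.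
pose e : B := (l / 2)%:C *: d.
have es : star e = e by rewrite starZ ds rc.
have ee : e * e = - phi b.
  have E : e * e = (l / 2 * (l / 2))%:C *: (d * d).
    by rewrite /e -scalerAl -scalerAr scalerA -rmorphM.
  have phib : phi b = (4^-1)%:C *: (phi x * phi x - (l ^+ 2)%:C *: 1).
    by rewrite linearZ/= raddfB/= rmorphM/= rmorph_alg.
  have E2 : d * d = 1 - (l^-1 ^+ 2)%:C *: (phi x * phi x).
    have X : (l^-1%:C *: phi x) * (l^-1%:C *: phi x) =
        (l^-1 ^+ 2)%:C *: (phi x * phi x).
      by rewrite -scalerAl -scalerAr scalerA -(rmorphM (real_complex R)).
    by rewrite -dd X addrC addKr.
  rewrite phib -scalerN opprB E E2 !scalerBr !scalerA -!(rmorphM (real_complex R)).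
  have l0' : l != 0 by rewrite gt_eqF.
  by congr (_%:C *: _ - _%:C *: _); field.
pose k := phi h.
have ks : star k = k by rewrite -phi_star hs.
have kx : GRing.comm k (phi x) by rewrite /GRing.comm /k -!rmorphM hx.
have ke : GRing.comm k e.
  rewrite /GRing.comm /e -scalerAl -scalerAr; congr (_ *: _); apply: dcomm.
  by rewrite /GRing.comm -scalerAl -scalerAr kx.
(* [w] is the image of [h^2 + b], that is, of [|b| + b]. *)
pose w := k * k - e * e.
have ws : star w = w by rewrite starB !starM ks es.
have kw : GRing.comm k w.
  by apply: commrB; apply: commrM.
have ew : GRing.comm e w.
  by apply: commrB; apply: commrM => //; exact: commr_sym.
(* [k^4 = e^4], both being the image of [b^2]. *)
have wk2 : w * (k * k + e * e) = 0.
  have kkee : GRing.comm (k * k) (e * e).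
    by apply: commrM; apply: commr_sym; apply: commrM; exact: commr_sym.
  rewrite /w mulrDr !mulrBl kkee.
  have -> : k * k * (k * k) = e * e * (e * e).
    by rewrite ee mulrNN /k -!rmorphM hh.
  by rewrite addrA subrK subrr.
have kwew : (k * w) * (k * w) + (e * w) * (e * w) = 0.
  have -> : (k * w) * (k * w) = w * (k * k) * w.
    by rewrite kw -!mulrA; congr (w * _); rewrite -kw mulrA.
  have -> : (e * w) * (e * w) = w * (e * e) * w.
    by rewrite ew -!mulrA; congr (w * _); rewrite -ew mulrA.
  by rewrite -mulrDl -mulrDr wk2 mul0r.
have kws : star (k * w) = k * w by rewrite starM ws ks kw.
have ews : star (e * w) = e * w by rewrite starM ws es ew.
have kwewC : (k * w) * (e * w) = (e * w) * (k * w).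
  rewrite -!mulrA (mulrA w) -ew (mulrA w) -kw -!mulrA (mulrA k) ke.
  by rewrite !mulrA.
(* Commuting self-adjoint elements whose squares add up to 0 fall under [csn_circle] with radius
   0. *)
have kw0 : k * w = 0.
  apply/rnorm_eq0/eqP; rewrite eq_le (csn_ge0 hB) andbT.
  by apply: (csn_circle hB kws ews kwewC (lexx 0)); rewrite kwew expr0n/= scale0r.
have ew0 : e * w = 0.
  apply/rnorm_eq0/eqP; rewrite eq_le (csn_ge0 hB) andbT.
  apply: (csn_circle hB ews kws (esym kwewC) (lexx 0)).
  by rewrite addrC kwew expr0n/= scale0r.
have w0 : w = 0.
  apply/rnorm_eq0/eqP; rewrite -sqrf_eq0 -(csnX2 hB)//.
  by rewrite {1}/w mulrBl -!mulrA kw0 ew0 !mulr0 subrr (csn0 hB).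
have hhb : h * h = - b.
  apply/eqP; rewrite -subr_eq0 opprK; apply/eqP/phi_inj.
  by rewrite rmorphD rmorphM/= -[phi b]opprK -ee.
(* [x^2 + (2 h)^2 = x^2 - 4 b = l^2], a circle of radius [l]. *)
have : rnorm x <= l.
  apply: (@csn_circle _ _ _ hA x (2%:C *: h)) => //.
  - by rewrite starZ hs rc.
  - by rewrite -scalerAl -scalerAr hx.
  - exact: ltW.
  rewrite -scalerAl -scalerAr scalerA hhb -rmorphM/= scalerN scalerA -rmorphM/=.
  have -> : (2 * 2 / 4 = 1 :> R) by field.
  by rewrite scale1r subKr.
by rewrite x1; lra.
Qed.

Lemma injective_star_morphism_isometric (x : A) :
  rnorm (phi x) <= rnorm x -> rnorm (phi x) = rnorm x.
Proof.
move=> xle; apply/eqP; rewrite eq_le xle leNgt; apply/negP => xlt.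
have x0 : 0 < rnorm x := le_lt_trans (csn_ge0 hB _) xlt.
pose k := (rnorm x ^+ 2)^-1.
have k0 : 0 < k by rewrite invr_gt0 exprn_gt0.
pose r0 := k * rnorm (phi x) ^+ 2.
have r00 : 0 <= r0 by rewrite mulr_ge0 ?sqr_ge0// ltW.
have r01 : r0 < 1.
  rewrite /r0 mulrC ltr_pdivrMr ?exprn_gt0// mul1r ltr_pXn2r// nnegrE//.
    exact: csn_ge0.
  exact: ltW.
(* Passing to the normalised [x^* x] makes the element self-adjoint. The midpoint of [r0] and 1 is
   strictly positive, as [isometry_sa] requires, even if [r0] is 0. *)
apply: (@isometry_sa (k%:C *: (star x * x)) ((1 + r0) / 2)).
- by rewrite starZ starM starK conjC_real_complex.
- by apply/andP; split; lra.
- rewrite (csnZ hA) cabs_real gtr0_norm// (csnC hA) mulVf//.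
  by rewrite expf_neq0// gt_eqF.
- rewrite linearZ/= rmorphM/= phi_star (csnZ hB) cabs_real gtr0_norm//.
  by rewrite (csnC hB) -/r0; lra.
Qed.

End Isometry.

(** * Completion *)

Section Completion.
Context {R : realType} {D : starAlgType R[i]} (p : D -> R)
  (hp : cstar_seminorm p) (p0 : forall x, p x = 0 -> x = 0).

Local Open Scope quotient_scope.

Record cauchy_seq := CauchySeq {
  cs_fun :> nat -> D;
  cs_cauchy : cauchy_for p cs_fun
}.

HB.instance Definition _ := gen_eqMixin cauchy_seq.
HB.instance Definition _ := gen_choiceMixin cauchy_seq.

Implicit Types (u v w : cauchy_seq) (s : D -> R).

Lemma cauchy_seq_ext u v : (forall n, u n = v n) -> u = v.
Proof.
case: u v => [u uc] [v vc] /= /funext uv; case: _ / uv vc => vc.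
by congr CauchySeq; apply: Prop_irrelevance.
Qed.

Lemma cauchy_for_cst x : cauchy_for p (fun=> x).
Proof. by move=> e e0; exists 0%N => i j _ _; rewrite subrr (csn0 hp). Qed.

Lemma cauchy_forD u v : cauchy_for p (fun n => u n + v n).
Proof.
move=> e e0; have e2 : 0 < e / 2 by rewrite divr_gt0.
have [N NP] := cs_cauchy u e2; have [M MP] := cs_cauchy v e2.
exists (maxn N M) => i j; rewrite !geq_max => /andP[Ni Mi] /andP[Nj Mj].
rewrite opprD addrACA (le_lt_trans (csnD hp _ _))// [e]splitr.
by rewrite ltrD ?NP ?MP.
Qed.

Lemma cauchy_forZ k u : cauchy_for p (fun n => k *: u n).
Proof.
move=> e e0; have k0 : 0 < cabs k + 1 by rewrite ltr_wpDl ?cabs_ge0.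
have [|N NP] := cs_cauchy u (e := e / (cabs k + 1)); first exact: divr_gt0.
exists N => i j Ni Nj; rewrite -scalerBr (csnZ hp).
have := NP i j Ni Nj; rewrite ltr_pdivlMr// => h; apply: le_lt_trans h.
by rewrite mulrC ler_wpM2l ?(csn_ge0 hp)// lerDl.
Qed.

Lemma cauchy_for_bounded u : exists2 K : R, 0 < K & forall n, p (u n) <= K.
Proof.
have [N NP] := cs_cauchy u ltr01.
pose K := 1 + p (u N) + \sum_(i < N) p (u i).
have s0 : 0 <= \sum_(i < N) p (u i) by apply: sumr_ge0 => i _; exact: csn_ge0.
have uN := csn_ge0 hp (u N).
exists K => [|n]; first by rewrite /K; lra.
have [nN|Nn] := ltnP n N.
  rewrite /K (bigD1 (Ordinal nN))//=.
  have : 0 <= \sum_(i < N | i != Ordinal nN) p (u i).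
    by apply: sumr_ge0 => i _; exact: csn_ge0.
  by lra.
have := csn_sub_trans hp (u N) (u n) 0; rewrite !subr0.
by have := NP n N Nn (leqnn N); rewrite /K; lra.
Qed.

Lemma cauchy_forM u v : cauchy_for p (fun n => u n * v n).
Proof.
have [K K0 uK] := cauchy_for_bounded u; have [L L0 vL] := cauchy_for_bounded v.
move=> e e0.
have [|N NP] := cs_cauchy u (e := e / (2 * L)).
  by rewrite divr_gt0// mulr_gt0.
have [|M MP] := cs_cauchy v (e := e / (2 * K)).
  by rewrite divr_gt0// mulr_gt0.
exists (maxn N M) => i j; rewrite !geq_max => /andP[Ni Mi] /andP[Nj Mj].
have -> : u i * v i - u j * v j = (u i - u j) * v i + u j * (v i - v j).
  by rewrite mulrBl mulrBr addrA subrK.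
rewrite (le_lt_trans (csnD hp _ _))// [e]splitr ltrD//.
- rewrite (le_lt_trans (csnM hp _ _))//.
  have := NP i j Ni Nj; rewrite ltr_pdivlMr ?mulr_gt0// => h.
  rewrite ltr_pdivlMr//; apply: le_lt_trans h.
  rewrite -mulrA ler_wpM2l ?(csn_ge0 hp)// mulrC ler_pM2l//.
- rewrite (le_lt_trans (csnM hp _ _))//.
  have := MP i j Mi Mj; rewrite ltr_pdivlMr ?mulr_gt0// => h.
  rewrite ltr_pdivlMr//; apply: le_lt_trans h.
  by rewrite mulrAC mulrC ler_wpM2l ?(csn_ge0 hp)// mulrC ler_pM2l.
Qed.

Lemma cauchy_for_star u : cauchy_for p (fun n => star (u n)).
Proof.
move=> e e0; have [N NP] := cs_cauchy u e0.
by exists N => i j Ni Nj; rewrite -starB (csn_star hp) NP.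
Qed.

Definition cs_cst x := CauchySeq (@cauchy_for_cst x).
Definition cs_add u v := CauchySeq (@cauchy_forD u v).
Definition cs_scale k u := CauchySeq (@cauchy_forZ k u).
Definition cs_mul u v := CauchySeq (@cauchy_forM u v).
Definition cs_star u := CauchySeq (@cauchy_for_star u).

Definition cs_null u v : Prop := (fun n => p (u n - v n)) @ \oo --> (0 : R).

Lemma cs_null_refl u : cs_null u u.
Proof. by rewrite /cs_null; under eq_fun do rewrite subrr (csn0 hp); exact: cvg_cst. Qed.

Lemma cs_null_sym u v : cs_null u v -> cs_null v u.
Proof. by rewrite /cs_null; under eq_fun do rewrite (csn_subC hp). Qed.

Lemma cs_null_trans v u w : cs_null u v -> cs_null v w -> cs_null u w.
Proof.
move=> uv vw; apply: (@cvg0_le _ _ (fun n => p (u n - v n) + p (v n - w n))).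
  by move=> n; rewrite (csn_ge0 hp) (csn_sub_trans hp).
by rewrite -[X in _ --> X]addr0; apply: cvgD.
Qed.

Definition cs_eqv u v : bool := `[< cs_null u v >].

Lemma cs_eqv_equiv : equiv_class_of cs_eqv.
Proof.
split=> [u|u v|v u w].
- exact/asboolP/cs_null_refl.
- by apply/idP/idP => /asboolP/cs_null_sym/asboolP.
- by move=> /asboolP uv /asboolP vw; apply/asboolP/(cs_null_trans uv).
Qed.

Canonical cs_eqv_rel := EquivRelPack cs_eqv_equiv.

(* [p0] makes the ring nontrivial: it is recorded in the type so that the
   instances below can be inferred. *)
Definition completion : Type := let _ := p0 in {eq_quot cs_eqv_rel}.
HB.instance Definition _ := Choice.on completion.
HB.instance Definition _ := EqQuotient.on completion.

Definition cls u : completion := \pi_completion u.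

Lemma cls_eq u v : cs_null u v -> cls u = cls v.
Proof. by move=> uv; apply/eqmodP/asboolP. Qed.

Lemma cls_inj u v : cls u = cls v -> cs_null u v.
Proof. by move=> /eqmodP/asboolP. Qed.

Lemma repr_null u : cs_null (repr (cls u)) u.
Proof. by apply: cls_inj; rewrite /cls reprK. Qed.

Lemma clsP (x : completion) : exists u, x = cls u.
Proof. by exists (repr x); rewrite /cls reprK. Qed.

Definition cp_add (x y : completion) := cls (cs_add (repr x) (repr y)).
Definition cp_scale k (x : completion) := cls (cs_scale k (repr x)).
Definition cp_mul (x y : completion) := cls (cs_mul (repr x) (repr y)).
Definition cp_star (x : completion) := cls (cs_star (repr x)).
Definition cp_opp (x : completion) := cp_scale (-1) x.

Lemma clsD u v : cp_add (cls u) (cls v) = cls (cs_add u v).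
Proof.
apply: cls_eq; apply: (@cvg0_le _ _ (fun n => p (repr (cls u) n - u n) +
   p (repr (cls v) n - v n))).
  by move=> n /=; rewrite (csn_ge0 hp) opprD addrACA (csnD hp).
by rewrite -[X in _ --> X]addr0; apply: cvgD; exact: repr_null.
Qed.

Lemma clsZ k u : cp_scale k (cls u) = cls (cs_scale k u).
Proof.
apply: cls_eq; rewrite /cs_null /=; under eq_fun do rewrite -scalerBr (csnZ hp).
suff : (fun n => cabs k * p (repr (cls u) n - u n)) @ \oo --> cabs k * 0.
  by rewrite mulr0.
by apply: cvgM; [exact: cvg_cst|exact: repr_null].
Qed.

Lemma clsM u v : cp_mul (cls u) (cls v) = cls (cs_mul u v).
Proof.
have [K K0 uK] := cauchy_for_bounded u.
have [L L0 vL] := cauchy_for_bounded (repr (cls v)).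
apply: cls_eq; apply: (@cvg0_le _ _ (fun n => p (repr (cls u) n - u n) * L +
   K * p (repr (cls v) n - v n))) => [n /=|].
  rewrite (csn_ge0 hp)/=.
  set a := repr (cls u) n; set b := repr (cls v) n.
  have -> : a * b - u n * v n = (a - u n) * b + u n * (b - v n).
    by rewrite mulrBl mulrBr addrA subrK.
  rewrite (le_trans (csnD hp _ _))// lerD// (le_trans (csnM hp _ _))//.
    by rewrite ler_wpM2l ?(csn_ge0 hp)//; exact: vL.
  by rewrite ler_wpM2r ?(csn_ge0 hp).
suff : (fun n => p (repr (cls u) n - u n) * L +
   K * p (repr (cls v) n - v n)) @ \oo --> 0 * L + K * 0.
  by rewrite mul0r mulr0 addr0.
by apply: cvgD; apply: cvgM; try exact: cvg_cst; exact: repr_null.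
Qed.

Lemma clsS u : cp_star (cls u) = cls (cs_star u).
Proof.
apply: cls_eq; rewrite /cs_null /=.
by under eq_fun do rewrite -starB (csn_star hp); exact: repr_null.
Qed.

Local Ltac cls_ext := apply: (congr1 cls); apply: cauchy_seq_ext => n /=.

Fact cp_addA : associative cp_add.
Proof.
move=> x y z; have [[u ->] [v ->]] := (clsP x, clsP y); have [w ->] := clsP z.
by rewrite !clsD; cls_ext; rewrite addrA.
Qed.
Fact cp_addC : commutative cp_add.
Proof.
by move=> x y; have [[u ->] [v ->]] := (clsP x, clsP y); rewrite !clsD;
  cls_ext; rewrite addrC.
Qed.
Fact cp_add0 : left_id (cls (cs_cst 0)) cp_add.
Proof. by move=> x; have [u ->] := clsP x; rewrite clsD; cls_ext; rewrite add0r. Qed.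
Fact cp_addN : left_inverse (cls (cs_cst 0)) cp_opp cp_add.
Proof.
move=> x; have [u ->] := clsP x; rewrite /cp_opp clsZ clsD; cls_ext.
by rewrite scaleN1r addNr.
Qed.

HB.instance Definition _ := GRing.isZmodule.Build completion
  cp_addA cp_addC cp_add0 cp_addN.

Fact cp_mulA : associative cp_mul.
Proof.
move=> x y z; have [[u ->] [v ->]] := (clsP x, clsP y); have [w ->] := clsP z.
by rewrite !clsM; cls_ext; rewrite mulrA.
Qed.
Fact cp_mul1 : left_id (cls (cs_cst 1)) cp_mul.
Proof. by move=> x; have [u ->] := clsP x; rewrite clsM; cls_ext; rewrite mul1r. Qed.
Fact cp_1mul : right_id (cls (cs_cst 1)) cp_mul.
Proof. by move=> x; have [u ->] := clsP x; rewrite clsM; cls_ext; rewrite mulr1. Qed.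
Fact cp_mulDl : left_distributive cp_mul cp_add.
Proof.
move=> x y z; have [[u ->] [v ->]] := (clsP x, clsP y); have [w ->] := clsP z.
by rewrite !(clsM, clsD); cls_ext; rewrite mulrDl.
Qed.
Fact cp_mulDr : right_distributive cp_mul cp_add.
Proof.
move=> x y z; have [[u ->] [v ->]] := (clsP x, clsP y); have [w ->] := clsP z.
by rewrite !(clsM, clsD); cls_ext; rewrite mulrDr.
Qed.
Fact cp_oner_neq0 : cls (cs_cst 1) != cls (cs_cst 0).
Proof.
apply/eqP => /cls_inj; rewrite /cs_null /= subr0 => h.
have p1 : p 1 = 0 by apply: (cvg_unique _ (@cvg_cst _ (p 1) nat \oo _) h).
by move/eqP: (p0 p1); rewrite oner_eq0.
Qed.

HB.instance Definition _ := GRing.Zmodule_isNzRing.Build completion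
  cp_mulA cp_mul1 cp_1mul cp_mulDl cp_mulDr cp_oner_neq0.

Fact cp_scaleA a b x : cp_scale a (cp_scale b x) = cp_scale (a * b) x.
Proof. by have [u ->] := clsP x; rewrite !clsZ; cls_ext; rewrite scalerA. Qed.
Fact cp_scale1 : left_id 1 cp_scale.
Proof. by move=> x; have [u ->] := clsP x; rewrite clsZ; cls_ext; rewrite scale1r. Qed.
Fact cp_scaleDr : right_distributive cp_scale cp_add.
Proof.
move=> k x y; have [[u ->] [v ->]] := (clsP x, clsP y).
by rewrite !(clsZ, clsD); cls_ext; rewrite scalerDr.
Qed.
Fact cp_scaleDl x : {morph cp_scale^~ x : a b / a + b >-> cp_add a b}.
Proof.
by move=> a b; have [u ->] := clsP x; rewrite !(clsZ, clsD); cls_ext; rewrite scalerDl.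
Qed.

HB.instance Definition _ := GRing.Zmodule_isLmodule.Build R[i] completion
  cp_scaleA cp_scale1 cp_scaleDr cp_scaleDl.

Fact cp_scaleAl k (x y : completion) : k *: (x * y) = k *: x * y.
Proof.
have [[u ->] [v ->]] := (clsP x, clsP y).
rewrite -[LHS]/(cp_scale _ (cp_mul _ _)) -[RHS]/(cp_mul (cp_scale _ _) _).
by rewrite !(clsZ, clsM); cls_ext; rewrite scalerAl.
Qed.

HB.instance Definition _ :=
  GRing.Lmodule_isLalgebra.Build R[i] completion cp_scaleAl.

Fact cp_scaleAr k (x y : completion) : k *: (x * y) = x * (k *: y).
Proof.
have [[u ->] [v ->]] := (clsP x, clsP y).
rewrite -[LHS]/(cp_scale _ (cp_mul _ _)) -[RHS]/(cp_mul _ (cp_scale _ _)).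
by rewrite !(clsZ, clsM); cls_ext; rewrite scalerAr.
Qed.

HB.instance Definition _ :=
  GRing.Lalgebra_isAlgebra.Build R[i] completion cp_scaleAr.

Fact cp_starK : involutive cp_star.
Proof. by move=> x; have [u ->] := clsP x; rewrite !clsS; cls_ext; rewrite starK. Qed.
Fact cp_starD : {morph cp_star : x y / x + y}.
Proof.
move=> x y; have [[u ->] [v ->]] := (clsP x, clsP y).
rewrite -![_ + _]/(cp_add _ _).
by rewrite !(clsS, clsD); cls_ext; rewrite starD.
Qed.
Fact cp_starZ (k : R[i]) x : cp_star (k *: x) = k^* *: cp_star x.
Proof.
have [u ->] := clsP x; rewrite -![_ *: _]/(cp_scale _ _).
by rewrite !(clsS, clsZ); cls_ext; rewrite starZ.
Qed.
Fact cp_starM x y : cp_star (x * y) = cp_star y * cp_star x.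
Proof.
have [[u ->] [v ->]] := (clsP x, clsP y); rewrite -![_ * _]/(cp_mul _ _).
by rewrite !(clsS, clsM); cls_ext; rewrite starM.
Qed.

HB.instance Definition _ := isStarAlgebra.Build R[i] completion
  cp_starK cp_starD cp_starZ cp_starM.

Lemma cls_add u v : cls u + cls v = cls (cs_add u v). Proof. exact: clsD. Qed.
Lemma cls_mul u v : cls u * cls v = cls (cs_mul u v). Proof. exact: clsM. Qed.
Lemma cls_scale k u : k *: cls u = cls (cs_scale k u). Proof. exact: clsZ. Qed.
Lemma cls_star u : star (cls u) = cls (cs_star u). Proof. exact: clsS. Qed.
Lemma cls_sub u v : cls u - cls v = cls (cs_add u (cs_scale (-1) v)).
Proof. by rewrite -scaleN1r cls_scale cls_add. Qed.

Definition cp_embed (x : D) : completion := cls (cs_cst x).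

Fact cp_embed_additive : {morph cp_embed : x y / x - y}.
Proof. by move=> x y; rewrite cls_sub; cls_ext; rewrite scaleN1r. Qed.
Fact cp_embed_multiplicative : monoid_morphism cp_embed.
Proof. by split=> // x y; rewrite cls_mul; cls_ext. Qed.
Fact cp_embed_scalable : scalable cp_embed.
Proof. by move=> k x; rewrite cls_scale; cls_ext. Qed.

HB.instance Definition _ := GRing.isZmodMorphism.Build D completion cp_embed cp_embed_additive.
HB.instance Definition _ := GRing.isMonoidMorphism.Build D completion cp_embed cp_embed_multiplicative.
HB.instance Definition _ := GRing.isScalable.Build R[i] D completion *:%R cp_embed cp_embed_scalable.

Lemma cp_embed_star : {morph cp_embed : x / star x}.
Proof. by move=> x; rewrite cls_star; cls_ext. Qed.

(** For [s = p] this is the norm of the completion. For the reduced norm below the full norm it is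
    the seminorm whose kernel is the exotic ideal. *)
Definition extend_seminorm s (x : completion) : R := lim (s (repr x n) @[n --> \oo]).

Section Extend.
Context (s : D -> R) (hs : cstar_seminorm s) (sp : forall x, s x <= p x).

Lemma extend_cls u : (fun n => s (u n)) @ \oo --> extend_seminorm s (cls u).
Proof.
have cv v : cvgn (fun n => s (v n)).
  apply/cauchy_cvgP/cauchy_ballP => e e0.
  have [N NP] := cs_cauchy v e0.
  pose S := (fun n => s (v n)) @` [set n | (N <= n)%N].
  exists (S, S) => /=; first by split; exists N => // n Nn; exists n.
  move=> [_ _] /= [[i Ni <-] [j Nj <-]]; rewrite /ball/=.
  rewrite (le_lt_trans (csn_dist hs _ _))// (le_lt_trans (sp _))//.
  exact: NP.
have /cvgrPdist_lt lu : cvgn (fun n => s (repr (cls u) n)) := cv _.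
apply/cvgrPdist_lt => e e0; have e2 : 0 < e / 2 by rewrite divr_gt0.
have /cvgrPdist_lt/(_ _ e2) nu := repr_null u.
move: (lu _ e2) nu; apply: filterS2 => n h1; rewrite sub0r normrN.
rewrite ger0_norm ?(csn_ge0 hp)// => h2.
rewrite (le_lt_trans (ler_distD (s (repr (cls u) n)) _ _))// [e]splitr ltrD//.
by rewrite (le_lt_trans (csn_dist hs _ _))// (le_lt_trans (sp _)).
Qed.

Lemma extend_eq u l : (fun n => s (u n)) @ \oo --> l ->
  extend_seminorm s (cls u) = l.
Proof. by move=> ul; apply: (cvg_unique _ (@extend_cls u) ul). Qed.

Lemma extend_embed x : extend_seminorm s (cp_embed x) = s x.
Proof. by apply: extend_eq => /=; exact: (@cvg_cst _ (s x)). Qed.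

Lemma extend_csn : cstar_seminorm (extend_seminorm s).
Proof.
split=> [x|x y|k x|x y|x]; have [u ->] := clsP x.
- by apply: (ler_cvg_to (@cvg_cst _ (0:R) nat \oo _) (@extend_cls u));
    apply: nearW => n; exact: csn_ge0.
- have [v ->] := clsP y; rewrite cls_add.
  apply: (ler_cvg_to (@extend_cls (cs_add u v))
    (cvgD (@extend_cls u) (@extend_cls v))).
  by apply: nearW => n /=; exact: csnD.
- rewrite cls_scale; apply: extend_eq => /=.
  under eq_fun do rewrite (csnZ hs).
  by apply: cvgM; [exact: cvg_cst|exact: extend_cls].
- have [v ->] := clsP y; rewrite cls_mul.
  apply: (ler_cvg_to (@extend_cls (cs_mul u v))
    (cvgM (@extend_cls u) (@extend_cls v))).
  by apply: nearW => n /=; exact: csnM.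
- rewrite cls_star cls_mul; apply: extend_eq => /=.
  under eq_fun do rewrite (csnC hs) expr2.
  by rewrite expr2; apply: cvgM; exact: extend_cls.
Qed.

End Extend.

Lemma extend_le s x : cstar_seminorm s -> (forall x, s x <= p x) ->
  extend_seminorm s x <= extend_seminorm p x.
Proof.
move=> hs sp; have [u ->] := clsP x.
apply: (ler_cvg_to (extend_cls hs sp (u:=u))
  (extend_cls hp (fun=> lexx _) (u:=u))).
exact: nearW.
Qed.

Let pbar := extend_seminorm p.
Let pbar_csn : cstar_seminorm pbar := extend_csn hp (fun=> lexx _).
Let pbar_cls u : (fun n => p (u n)) @ \oo --> pbar (cls u) :=
  extend_cls hp (fun=> lexx _) (u:=u).

Let pbar_eq0 x : pbar x = 0 -> x = 0.
Proof.
have [u ->] := clsP x => u0; apply: cls_eq; rewrite /cs_null /=.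
by under eq_fun do rewrite subr0; rewrite -u0; exact: pbar_cls.
Qed.

Let pbar_sub_embed u e : 0 < e ->
  exists N, forall n, (N <= n)%N -> pbar (cls u - cp_embed (u n)) <= e.
Proof.
move=> e0; have [N NP] := cs_cauchy u e0; exists N => n Nn.
rewrite cls_sub.
apply: (ler_cvg_to (@pbar_cls _) (@cvg_cst _ e nat \oo _)); exists N => // m Nm.
by rewrite /= scaleN1r ltW// NP.
Qed.

Lemma cp_embed_dense x e : 0 < e -> exists d, pbar (x - cp_embed d) <= e.
Proof.
have [u ->] := clsP x => /(pbar_sub_embed u)[N NP].
by exists (u N); exact: NP.
Qed.

Fact cp_norm_cstar : cstar_norm (fun x : completion => (pbar x)%:C).
Proof. exact: (csn_cstar_norm pbar_csn pbar_eq0). Qed.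

(** A Cauchy sequence of classes is replaced by elements [d n] of [D] within [1 / (n + 1)] of its
    terms; [d] is Cauchy for [p] and its class is the limit. *)
Fact cp_norm_complete : norm_complete (fun x : completion => (pbar x)%:C).
Proof.
move=> x xc.
have d_ex n : exists d, pbar (x n - cp_embed d) <= n.+1%:R^-1.
  by apply: cp_embed_dense; rewrite invr_gt0.
have [d dP] := choice d_ex.
have inv_small (e : R) : 0 < e -> exists N, forall n, (N <= n)%N -> n.+1%:R^-1 < e.
  move=> e0; have /cvgrPdist_lt/(_ _ e0)[N _ NP] := @cvg_harmonic R.
  exists N => n /NP /=.
  by rewrite sub0r normrN ger0_norm.
have xcR (e : R) : 0 < e -> exists N, forall m n, (N <= m)%N -> (N <= n)%N ->
    pbar (x m - x n) < e.
  move=> e0; have [|N NP] := xc e%:C; first by rewrite ltr0_complex.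
  by exists N => m n Nm Nn; have := NP m n Nm Nn; rewrite ltcR.
have dc : cauchy_for p d.
  move=> e e0; have e3 : 0 < e / 3 by rewrite divr_gt0.
  have [N NP] := xcR _ e3; have [M MP] := inv_small _ e3.
  exists (maxn N M) => i j; rewrite !geq_max => /andP[Ni Mi] /andP[Nj Mj].
  rewrite -(extend_embed hp (fun=> lexx _)) -/pbar raddfB/=.
  have dM k : (M <= k)%N -> pbar (x k - cp_embed (d k)) < e / 3.
    by move=> /MP; exact: le_lt_trans.
  apply: le_lt_trans (csn_sub_trans pbar_csn (x i) _ _) _.
  rewrite (csn_subC pbar_csn (cp_embed (d i)) (x i)).
  have -> : e = e / 3 + (e / 3 + e / 3) by field.
  apply: ltrD; first exact: dM.
  by apply: le_lt_trans (csn_sub_trans pbar_csn (x j) _ _) (ltrD _ _); [exact: NP|exact: dM].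
exists (cls (CauchySeq dc)) => _ /complex_pos_exists[e e0 ->].
have e2 : 0 < e / 2 by rewrite divr_gt0.
have [N NP] := pbar_sub_embed (CauchySeq dc) e2; have [M MP] := inv_small _ e2.
exists (maxn N M) => n; rewrite geq_max => /andP[Nn Mn]; rewrite ltcR.
apply: le_lt_trans (csn_sub_trans pbar_csn (cp_embed (d n)) _ _) _.
rewrite (csn_subC pbar_csn (cp_embed (d n)) (cls _)) [e]splitr ltr_leD ?NP//.
exact: le_lt_trans (dP n) (MP n Mn).
Qed.

HB.instance Definition _ := isCstarAlgebra.Build R[i] completion
  cp_norm_cstar cp_norm_complete.

Lemma completion_rnorm (x : completion) : rnorm x = extend_seminorm p x.
Proof. by []. Qed.

End Completion.

(** * The space of colourings and its invariant mean *)

Section Order.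
Context {G : groupType}.
Implicit Types (s t u : G).

(* The value 2 in the infinite case makes every power map of [s] compatible
   with counting modulo [gorder s]. *)
Definition gorder s : nat :=
  if pselect (exists n, (0 < n)%N && (s ^+ n == 1)%g) is left h
  then ex_minn h else 2%N.

Lemma gorder_gt0 s : (0 < gorder s)%N.
Proof.
by rewrite /gorder; case: pselect => // h; case: ex_minnP => n /andP[].
Qed.

Lemma gorder_gt1 s : s != 1%g -> (1 < gorder s)%N.
Proof.
rewrite /gorder; case: pselect => // h; case: ex_minnP => -[|[|n]]//.
by rewrite expg1 => /= /eqP -> _; rewrite eqxx.
Qed.

(** For infinite order the exponents coincide, whatever the modulus. Otherwise a non-zero remainder
    of their difference would contradict the minimality of the order. *)
Lemma expg_gorder s k l : (s ^+ k = s ^+ l)%g -> k = l %[mod gorder s].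
Proof.
wlog kl : k l / (k <= l)%N.
  by move=> h; have [/h//|/ltnW lk /esym/(h _ _ lk)] := leqP k l.
move=> skl; have s1 : (s ^+ (l - k) = 1)%g by rewrite expgnFr// skl mulgV.
apply/esym/eqP; rewrite eqn_mod_dvd//; move: s1; set d := (l - k)%N => s1.
rewrite /gorder; case: pselect => [h|h]; last first.
  have [->|d0] := posnP d; first exact: dvdn0.
  by case: h; exists d; rewrite d0 s1 eqxx.
case: ex_minnP => n /andP[n0 /eqP sn] nmin.
rewrite /dvdn; apply/eqP/eqP; rewrite -leqn0 leqNgt; apply/negP => r0.
have : (n <= d %% n)%N.
  apply: nmin; rewrite r0/=; apply/eqP; move: s1.
  by rewrite {1}(divn_eq d n) mulnC expgnDr expgnA sn expg1n mul1g.
by rewrite leqNgt ltn_mod n0.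
Qed.

(** Natural exponents on both sides stand for one integer exponent: [t] and [u] lie in the same left
    coset of the subgroup generated by [s]. *)
Definition same_coset s t u : Prop := exists k l, (t * s ^+ k = u * s ^+ l)%g.

Lemma same_coset_refl s t : same_coset s t t.
Proof. by exists 0%N, 0%N. Qed.

Lemma same_cosetSr s t u : same_coset s t (u * s)%g <-> same_coset s t u.
Proof.
split=> -[k [l h]].
  by exists k, l.+1; rewrite h expgS mulgA.
by exists k.+1, l; rewrite expgSr mulgA h -!mulgA -expgSr expgS.
Qed.

Lemma same_coset_sym s t u : same_coset s t u -> same_coset s u t.
Proof. by move=> [k [l h]]; exists l, k. Qed.

Lemma same_coset_mull s v t u :
  same_coset s (v * t)%g (v * u)%g <-> same_coset s t u.
Proof.
split=> -[k [l h]]; exists k, l; last by rewrite -!mulgA h.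
by move: h; rewrite -!mulgA => /mulgI.
Qed.

End Order.

(** * The compact metric space of colourings and its free action *)

Section Coloring.
Context {G : groupType} {e : nat -> G * G}.

(* The parameters [R] and [he] only serve to attach a metric to the type. *)
Record coloring (R : realType) (he : forall i, exists n, e n = i) := Coloring {
  col :> G -> G -> nat;
  col_lt : forall s t, (col s t < gorder s)%N;
  col_step : forall s t, col s (t * s)%g = ((col s t).+1 %% gorder s)%N
}.

Context {R : realType} {he : forall i, exists n, e n = i}.
Local Notation X := (coloring R he).
Implicit Types (x y z : X) (s t u : G).

HB.instance Definition _ := gen_eqMixin X.
HB.instance Definition _ := gen_choiceMixin X.

Lemma coloring_ext x y : (forall s t, x s t = y s t) -> x = y.
Proof.
case: x y => [x x1 x2] [y y1 y2] /= h.
have xy : x = y by apply/funext => s; apply/funext => t.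
by case: _ / xy y1 y2 {h} => y1 y2; congr Coloring; exact: Prop_irrelevance.
Qed.

Definition colp x (i : G * G) : nat := x i.1 i.2.

Lemma col_expg x s t k : x s (t * s ^+ k)%g = ((x s t + k) %% gorder s)%N.
Proof.
elim: k => [|k IH]; first by rewrite expg0 mulg1 addn0 modn_small ?col_lt.
by rewrite expgSr mulgA col_step IH -addn1 modnDml -addnA addn1.
Qed.

Lemma col_same_coset x y s t u : same_coset s t u -> x s t = y s t ->
  x s u = y s u.
Proof.
move=> [k [l h]] xy.
have : x s (u * s ^+ l)%g = y s (u * s ^+ l)%g by rewrite -h !col_expg xy.
rewrite !col_expg => /eqP; rewrite eqn_modDr => /eqP.
by rewrite !modn_small ?col_lt.
Qed.

(** [e] enumerates the coordinates, and the metric induces the topology of pointwise convergence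
    ([nbhs_coloring]). *)
Definition first_diff_dist x y : R :=
  if pselect (exists n, colp x (e n) != colp y (e n)) is left h
  then (ex_minn h).+1%:R^-1 else 0.

Lemma dist_ge x y n : colp x (e n) != colp y (e n) ->
  n.+1%:R^-1 <= first_diff_dist x y.
Proof.
move=> xyn; rewrite /first_diff_dist; case: pselect => [h|[]]; last by exists n.
case: ex_minnP => m _ mmin.
by rewrite lef_pV2 ?posrE ?ltr0n// ler_nat ltnS mmin.
Qed.

Lemma dist_lt x y N : (forall n, (n <= N)%N -> colp x (e n) = colp y (e n)) ->
  first_diff_dist x y < N.+1%:R^-1.
Proof.
move=> h; rewrite /first_diff_dist; case: pselect => [d|]; last by rewrite invr_gt0.
case: ex_minnP => m xym _; rewrite ltf_pV2 ?posrE ?ltr0n// ltr_nat ltnS ltnNge.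
by apply/negP => /h/eqP; rewrite (negbTE xym).
Qed.

Lemma dist_lt_agree x y N n : first_diff_dist x y < N.+1%:R^-1 -> (n <= N)%N ->
  colp x (e n) = colp y (e n).
Proof.
move=> xyN nN; apply/eqP; apply: contraTT xyN => /dist_ge xyn.
by rewrite -leNgt (le_trans _ xyn)// lef_pV2 ?posrE ?ltr0n// ler_nat.
Qed.

Fact distxx x : first_diff_dist x x = 0.
Proof.
rewrite /first_diff_dist; case: pselect => // h.
by exfalso; have [n] := h; rewrite eqxx.
Qed.

Fact dist_positivity x y : first_diff_dist x y = 0 -> x = y.
Proof.
rewrite /first_diff_dist; case: pselect => [h|h _].
  by move/eqP; rewrite invr_eq0 pnatr_eq0.
apply: coloring_ext => s t; have [n en] := he (s, t).
apply/eqP/negPn/negP => xy; apply: h; exists n.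
by rewrite /colp en.
Qed.

Fact dist_sym x y : first_diff_dist x y = first_diff_dist y x.
Proof.
have le a b : first_diff_dist a b <= first_diff_dist b a.
  rewrite {1}/first_diff_dist; case: pselect => [h|_].
    by case: ex_minnP => m abm _; apply: dist_ge; rewrite eq_sym.
  by rewrite /first_diff_dist; case: pselect => // h; rewrite invr_ge0.
by apply/eqP; rewrite eq_le !le.
Qed.

(** At the first coordinate where [x] and [z] differ, [y] differs from one of them, so one summand
    alone is large enough. *)
Fact dist_triangle y x z :
  first_diff_dist x z <= first_diff_dist x y + first_diff_dist y z.
Proof.
have ge0 a b : 0 <= first_diff_dist a b.
  by rewrite /first_diff_dist; case: pselect => // h; rewrite invr_ge0.
rewrite {1}/first_diff_dist; case: pselect => [h|_]; last by rewrite addr_ge0.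
case: ex_minnP => m xzm _.
have [xym|/dist_ge xym] := eqVneq (colp x (e m)) (colp y (e m)).
  by rewrite -[leLHS]add0r lerD// dist_ge// -xym.
by rewrite -[leLHS]addr0 lerD.
Qed.

HB.instance Definition _ := isMetric.Build R X
  distxx dist_positivity dist_sym dist_triangle.

Lemma ball_coloring x r : ball x r = [set y | first_diff_dist x y < r].
Proof. by []. Qed.

Lemma inv_lt (r : R) : 0 < r -> exists N : nat, N.+1%:R^-1 < r.
Proof.
move=> r0; exists (Num.bound r^-1).
rewrite invf_plt ?posrE ?ltr0n//.
have := archi_boundP (ltW (_ : 0 < r^-1)); rewrite invr_gt0 => /(_ r0).
by move=> /lt_trans; apply; rewrite ltr_nat.
Qed.

Lemma nbhs_coloring x (A : set X) : nbhs x A <->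
  exists N, forall y, (forall n, (n <= N)%N -> colp x (e n) = colp y (e n)) -> A y.
Proof.
split=> [/nbhs_ballP[r /= r0 rA]|[N NA]].
  have [N Nr] := inv_lt r0; exists N => y xy; apply: rA.
  by rewrite ball_coloring /=; apply: lt_trans (dist_lt xy) Nr.
apply/nbhs_ballP; exists N.+1%:R^-1; first by rewrite /= invr_gt0.
by move=> y; rewrite ball_coloring /= => xy; apply: NA => n; exact: dist_lt_agree.
Qed.

(** Each coordinate takes finitely many values, so an ultrafilter selects one of them. The selected
    values again form a colouring, because each relation involves two coordinates and holds at any
    point of a suitable member of the ultrafilter. *)
Lemma coloring_compact : compact [set: X].
Proof.
rewrite compact_ultra => F FU _.
have val i : exists v, F [set z | colp z i = v].
  apply: contrapT => nv.
  have neq v : F [set z | colp z i <> v].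
    have [Fv|//] := in_ultra_setVsetC [set z | colp z i = v] FU.
    by case: nv; exists v.
  have all n : F [set z | forall v, (v < n)%N -> colp z i <> v].
    elim: n => [|n IH]; first by apply: filterS filterT.
    apply: filterS2 IH (neq n) => z zn zv v; rewrite ltnS leq_eqVlt.
    by move=> /orP[/eqP ->//|]; exact: zn.
  have [z zP] := filter_ex (all (gorder i.1)).
  by apply: (zP (colp z i)) => //; exact: col_lt.
have [v vP] := choice val.
have vlt s t : (v (s, t) < gorder s)%N.
  by have [z <-] := filter_ex (vP (s, t)); exact: col_lt.
have vstep s t : v (s, t * s)%g = ((v (s, t)).+1 %% gorder s)%N.
  have [z [<- <-]] := filter_ex (filterI (vP (s, t * s)%g) (vP (s, t))).
  exact: col_step.
pose x : X := @Coloring R he (fun s t => v (s, t)) vlt vstep.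
exists x; split=> //= A /nbhs_coloring[N NA].
have agree n : F [set z | forall m, (m < n)%N -> colp x (e m) = colp z (e m)].
  elim: n => [|n IH]; first by apply: filterS filterT.
  apply: filterS2 IH (vP (e n)) => z zn zv m; rewrite ltnS leq_eqVlt.
  move=> /orP[/eqP ->|]; last exact: zn.
  by rewrite zv /colp /x /=; case: (e n).
by apply: filterS (agree N.+1) => z zP; apply: NA => n nN; exact: zP.
Qed.

(** Count from a chosen representative [r] of each left coset: [r s^m] gets the colour [m] modulo
    [gorder s], which is well defined by [expg_gorder]. *)
Lemma coloring_point_exists : exists c : G -> G -> nat,
  (forall s t, (c s t < gorder s)%N) /\
  (forall s t, c s (t * s)%g = ((c s t).+1 %% gorder s)%N).
Proof.
pose r s t := xget 1%g [set u | same_coset s t u].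
have rS s t : r s (t * s)%g = r s t.
  congr xget; apply/seteqP; split=> u /=.
    by move=> /same_coset_sym/same_cosetSr/same_coset_sym.
  by move=> /same_coset_sym h; apply/same_coset_sym/same_cosetSr.
pose P s t c := (c < gorder s)%N /\
  exists k l, (t * s ^+ k = r s t * s ^+ l)%g /\ (c + k = l %[mod gorder s])%N.
have Pex st : exists c, P st.1 st.2 c.
  case: st => s t /=.
  have : same_coset s t (r s t).
    by rewrite /r; apply: (@xgetPex _ 1%g [set u | same_coset s t u]);
       exists t; exact: same_coset_refl.
  (* The residue of [l - k], written without subtraction. *)
  move=> [k [l h]]; exists (((l + k * (gorder s).-1) %% gorder s)%N).
  split; first by rewrite ltn_mod gorder_gt0.
  exists k, l; split=> //; rewrite modnDml -addnA -mulnSr prednK ?gorder_gt0//.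
  by rewrite addnC modnMDl.
have Puniq s t c d : P s t c -> P s t d -> c = d.
  move=> [cn [k [l [h hc]]]] [dn [k' [l' [h' hd]]]].
  have lk : (l + k' = l' + k %[mod gorder s])%N.
    apply: expg_gorder; apply: (@mulgI _ (r s t)).
    rewrite !expgnDr !mulgA -h -h' -!mulgA -!expgnDr addnC//.
  suff : (c + (k + k') = d + (k + k') %[mod gorder s])%N.
    by move=> /eqP; rewrite eqn_modDr !modn_small// => /eqP.
  rewrite !addnA -modnDml hc modnDml lk addnAC -(modnDml (d + k')) hd.
  by rewrite modnDml.
have [c cP] := choice Pex.
exists (fun s t => c (s, t)); split=> s t; first by case: (cP (s, t)).
apply: (Puniq s (t * s)%g); first exact: (cP (s, (t * s)%g)).
have [_ [k [l [h hc]]]] := cP (s, t); split; first by rewrite ltn_mod gorder_gt0.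
exists k, l.+1; split.
  by rewrite rS -mulgA -expgS expgSr mulgA h -mulgA -expgSr.
by rewrite modnDml addSn -addn1 -modnDml hc modnDml addn1.
Qed.

Definition coloring_point : X :=
  let h := cid coloring_point_exists in
  @Coloring R he (projT1 h) (projT2 h).1 (projT2 h).2.

HB.instance Definition _ := isPointed.Build X coloring_point.

Definition gact u z : X := @Coloring R he (fun s t => z s (u^-1 * t)%g)
  (fun s t => col_lt z s (u^-1 * t)%g)
  (fun s t => eq_trans (congr1 (z s) (mulgA u^-1%g t s)) (col_step z s (u^-1 * t)%g))
 .

Fact gact1 z : gact 1%g z = z.
Proof. by apply: coloring_ext => s t /=; rewrite invg1 mul1g. Qed.

Fact gactM u v z : gact (u * v)%g z = gact u (gact v z).
Proof. by apply: coloring_ext => s t /=; rewrite invgM mulgA. Qed.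

Fact gact_continuous u : continuous (gact u).
Proof.
move=> z A /nbhs_coloring[N NA]; apply/nbhs_coloring.
have [idx idxP] := choice he.
pose j n := idx ((e n).1, u^-1 * (e n).2)%g.
exists (\max_(n < N.+1) j n)%N => y zy /=; apply: NA => n nN.
have := zy (j n); rewrite /colp /j !idxP /=; apply.
exact: (@leq_bigmax _ (fun n : 'I_N.+1 => j n) (Ordinal (nN : (n < N.+1)%N))).
Qed.

Definition coloring_action : top_action G X :=
  TopAction gact1 gactM gact_continuous.

(** Compare the colours [z_s] at the point [s]: the translate of [x] has [x_s(1)] there, while [x]
    has [x_s(1) + 1] modulo [gorder s > 1]. *)
Lemma coloring_action_free : free_action coloring_action.
Proof.
move=> s x s1 /(congr1 (fun y : X => y s s)) /=.
rewrite mulVg -[RHS](congr1 (x s) (mul1g s)) col_step => h.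
have := gorder_gt1 s1; have := col_lt x s 1%g; rewrite leq_eqVlt.
move=> /orP[/eqP xs|xs].
  by move: h; rewrite xs modnn => h; rewrite -xs h.
by move: h; rewrite modn_small// => /n_Sn.
Qed.

Fact bump_lt (i : G * G) j z s t :
  ((if (s == i.1) && `[< same_coset i.1 i.2 t >] then ((z s t + j) %% gorder s)%N
    else z s t) < gorder s)%N.
Proof. by case: ifP => _; rewrite ?ltn_mod ?gorder_gt0 ?col_lt. Qed.

Fact bump_step (i : G * G) j z s t :
  (if (s == i.1) && `[< same_coset i.1 i.2 (t * s)%g >]
    then ((z s (t * s)%g + j) %% gorder s)%N else z s (t * s)%g) =
  ((if (s == i.1) && `[< same_coset i.1 i.2 t >] then (z s t + j) %% gorder s
    else z s t).+1 %% gorder s)%N.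
Proof.
case: eqP => [->|_] /=; last exact: col_step.
rewrite (asbool_equiv_eq (same_cosetSr _ _ _)) col_step; case: ifP => // _.
by rewrite modnDml -addn1 -[in RHS]addn1 modnDml addnAC.
Qed.

Definition bump (i : G * G) j z : X :=
  @Coloring R he _ (bump_lt i j z) (bump_step i j z).

Lemma bumpE i j z s t : bump i j z s t =
  if (s == i.1) && `[< same_coset i.1 i.2 t >] then ((z s t + j) %% gorder s)%N
  else z s t.
Proof. by []. Qed.

Lemma bumpC i i' j j' z : bump i j (bump i' j' z) = bump i' j' (bump i j z).
Proof.
apply: coloring_ext => s t; rewrite !bumpE.
by case: ifP; case: ifP => // _ _; rewrite !modnDml addnAC.
Qed.

Lemma bump_gact i j u z :
  bump i j (gact u z) = gact u (bump (i.1, u^-1 * i.2)%g j z).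
Proof.
apply: coloring_ext => s t; rewrite bumpE /=.
by rewrite (asbool_equiv_eq (same_coset_mull _ u^-1%g _ _)).
Qed.

(** * Averages over rotations and the mean they define *)

Implicit Types (f g : X -> R) (i : G * G) (l : seq (G * G)).

Definition avg i f z : R :=
  (gorder i.1)%:R^-1 * \sum_(j < gorder i.1) f (bump i j z).

Definition avgs l f : X -> R := foldr avg f l.

Let n0 i : (gorder i.1)%:R != 0 :> R.
Proof. by rewrite pnatr_eq0 -lt0n gorder_gt0. Qed.

Lemma avgC i i' f : avg i (avg i' f) = avg i' (avg i f).
Proof.
apply/funext => z; rewrite /avg.
under eq_bigr do rewrite mulr_sumr; rewrite exchange_big /= mulr_sumr.
rewrite [RHS]mulr_sumr; apply: eq_bigr => j' _.
rewrite -!mulr_sumr mulrCA; congr (_ * (_ * _)).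
by apply: eq_bigr => j _; rewrite bumpC.
Qed.

Lemma avg_avgsC i l f : avg i (avgs l f) = avgs l (avg i f).
Proof. by elim: l => //= i' l <-; rewrite avgC. Qed.

Lemma avgs_cat l l' f : avgs (l ++ l') f = avgs l (avgs l' f).
Proof. by rewrite /avgs foldr_cat. Qed.

Lemma avgsC l l' f : avgs l (avgs l' f) = avgs l' (avgs l f).
Proof. by elim: l => //= i l ->; rewrite avg_avgsC. Qed.

Lemma avgsD l f g : avgs l (fun z => f z + g z) = fun z => avgs l f z + avgs l g z.
Proof.
elim: l => //= i l ->; apply/funext => z.
by rewrite /avg big_split/= mulrDr.
Qed.

Lemma avgsZ l k f : avgs l (fun z => k * f z) = fun z => k * avgs l f z.
Proof.
elim: l => //= i l ->; apply/funext => z.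
by rewrite /avg -mulr_sumr mulrCA.
Qed.

Lemma avgs_cst l c : avgs l (fun=> c) = fun=> c.
Proof.
elim: l => //= i l ->; apply/funext => z.
by rewrite /avg sumr_const card_ord -[c *+ _]mulr_natl mulKf.
Qed.

Lemma avgs_le l f g : (forall z, f z <= g z) -> forall z, avgs l f z <= avgs l g z.
Proof.
move=> fg; elim: l => //= i l IH z.
by rewrite /avg ler_wpM2l ?invr_ge0// ler_sum.
Qed.

Lemma avgs_near l f c (r : R) : (forall z, `|f z - c| <= r) ->
  forall z, `|avgs l f z - c| <= r.
Proof.
move=> h z; rewrite ler_distl; apply/andP; split.
  rewrite -[leLHS](congr1 (fun f => f z) (avgs_cst l _)).
  by apply: avgs_le => y; have := h y; rewrite ler_distl => /andP[].
rewrite -[leRHS](congr1 (fun f => f z) (avgs_cst l _)).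
by apply: avgs_le => y; have := h y; rewrite ler_distl => /andP[].
Qed.

Lemma avgs_gact l f u :
  avgs l (f \o gact u) = avgs [seq (i.1, u * i.2)%g | i <- l] f \o gact u.
Proof.
elim: l => //= i l ->; apply/funext => z; rewrite /avg /=; congr (_ * _).
apply: eq_bigr => j _; rewrite bump_gact /=.
by rewrite mulKg -surjective_pairing.
Qed.

(** The tolerance [r] is what uniform continuity provides; averaging does not increase it. *)
Definition depends_on l (r : R) f : Prop :=
  forall x y, (forall i, i \in l -> colp x i = colp y i) -> `|f x - f y| <= r.

(** Reindexing the rotations of [y] makes its colour at [i] agree with that of the rotated [x],
    hence also on the whole coset. Coordinates off this coset are not moved, so coordinate [i] no
    longer matters. *)
Lemma avg_depends_on i l r f : depends_on (i :: l) r f ->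
  depends_on l r (avg i f).
Proof.
move=> fP x y xy; set n := gorder i.1.
have n_gt0 : (0 < n)%N := gorder_gt0 _.
(* The shift taking the colour of [y] at [i] to that of [x] modulo [n]. *)
pose d := (colp x i + (n - colp y i))%N.
have yin : (colp y i < n)%N := col_lt y i.1 i.2.
have reindex : \sum_(j < n) f (bump i j y) =
    \sum_(j < n) f (bump i ((j + d) %% n)%N y).
  pose h (j : 'I_n) : 'I_n := Ordinal (ltn_pmod (j + d) n_gt0).
  rewrite (reindex_inj (h := h))//= => j j' /(congr1 val)/= /eqP.
  by rewrite eqn_modDr !modn_small// => /eqP/val_inj.
rewrite /avg -/n reindex -mulrBr normrM ger0_norm ?invr_ge0//.
rewrite ler_pdivrMl ?ltr0n// -sumrB (le_trans (ler_norm_sum _ _ _))//.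
have -> : n%:R * r = \sum_(j < n) r by rewrite sumr_const card_ord mulr_natl.
apply: ler_sum => j _; apply: fP => k.
have here : colp (bump i j x) i = colp (bump i ((j + d) %% n) y) i.
  rewrite /colp !bumpE eqxx; have /asboolP -> := same_coset_refl i.1 i.2 => /=.
  rewrite -!/(colp _ i) -/n modnDmr /d addnCA (addnCA (colp y i)) subnKC ?(ltnW yin)//.
  by rewrite addnCA (addnA (colp x i)) -[in RHS]modnDmr modnn addn0 addnC.
rewrite inE => /orP[/eqP -> //|kl].
have [ik|nik] := boolP ((k.1 == i.1) && `[< same_coset i.1 i.2 k.2 >]).
  move: ik => /andP[/eqP k1 /asboolP ik2].
  by rewrite /colp k1; apply: col_same_coset ik2 here.
by rewrite /colp !bumpE (negbTE nik); exact: xy.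
Qed.

Lemma avgs_depends_on l r f : depends_on l r f -> depends_on [::] r (avgs l f).
Proof.
elim: l f => // i l IH f /avg_depends_on/IH.
by rewrite -avg_avgsC.
Qed.

Definition has_mean f (c : R) : Prop :=
  forall r, 0 < r -> exists l, forall z, `|avgs l f z - c| <= r.

(** Apply both families of averages. Since they commute, either may act last, and averaging keeps a
    function near a constant to which it is already near. *)
Lemma has_meanD f g c d : has_mean f c -> has_mean g d ->
  has_mean (fun z => f z + g z) (c + d).
Proof.
move=> fc gd r r0; have r2 : 0 < r / 2 by rewrite divr_gt0.
have [l lP] := fc _ r2; have [l' l'P] := gd _ r2.
exists (l ++ l') => z; rewrite avgsD opprD addrACA [r]splitr.
rewrite (le_trans (ler_normD _ _))// lerD//.
  by rewrite avgs_cat avgsC avgs_near.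
by rewrite avgs_cat avgs_near.
Qed.

Lemma has_meanZ k f c : has_mean f c -> has_mean (fun z => k * f z) (k * c).
Proof.
move=> fc r r0; have k0 : 0 < `|k| + 1 by rewrite ltr_wpDl.
have [|l lP] := fc (r / (`|k| + 1)); first exact: divr_gt0.
exists l => z; rewrite avgsZ -mulrBr normrM.
have := lP z; rewrite ler_pdivlMr// => h; apply: le_trans h.
by rewrite mulrC ler_wpM2l// lerDl.
Qed.

Lemma has_mean_cst c : has_mean (fun=> c) c.
Proof. by move=> r r0; exists [::] => z /=; rewrite subrr normr0 ltW. Qed.

Lemma has_mean_ge0 f c : (forall z, 0 <= f z) -> has_mean f c -> 0 <= c.
Proof.
move=> f0 fc; rewrite leNgt; apply/negP => c0.
have [|l lP] := fc (- c / 2); first by rewrite divr_gt0// oppr_gt0.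
have := lP coloring_point; rewrite ler_distl => /andP[_].
have : 0 <= avgs l f coloring_point.
  rewrite -[leLHS](congr1 (fun f => f coloring_point) (avgs_cst l 0)).
  exact: avgs_le.
by lra.
Qed.

(** By additivity [f - f = 0] has the mean [c - d], hence also [d - c], and both are
    non-negative. *)
Lemma has_mean_uniq f c d : has_mean f c -> has_mean f d -> c = d.
Proof.
move=> fc /(has_meanZ (-1)) fd; have := has_meanD fc fd.
have -> : (fun z => f z + -1 * f z) = fun=> 0.
  by apply/funext => z; rewrite mulN1r subrr.
move=> h; have := has_meanZ (-1) h; move: h.
rewrite !mulN1r oppr0 => h h'.
apply/eqP; rewrite -subr_eq0 eq_le; apply/andP; split.
  by rewrite -oppr_ge0; exact: has_mean_ge0 h'.
exact: has_mean_ge0 h.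
Qed.

Lemma has_mean_gact f c u : has_mean f c -> has_mean (f \o gact u) c.
Proof.
move=> fc r /fc[l lP]; exists [seq (i.1, u^-1 * i.2)%g | i <- l] => z.
rewrite avgs_gact -map_comp /= (_ : [seq _ | i <- l] = l)//.
by rewrite -[RHS]map_id; apply: eq_map => i /=; rewrite mulVKg -surjective_pairing.
Qed.

Lemma has_mean_exists f :
  (forall r, 0 < r -> exists l, depends_on l r f) -> exists c, has_mean f c.
Proof.
(* The mean is the supremum of the constants lying below some average of [f]. As averages commute,
   such a constant cannot exceed the maximum of any other average, which [Sub] bounds for a nearly
   constant one. *)
move=> fP; pose S := [set b | exists l, forall z, b <= avgs l f z].
have osc r : 0 < r -> exists l, forall z, `|avgs l f z - avgs l f coloring_point| <= r.
  by move=> /fP[l /avgs_depends_on lP]; exists l => z; exact: lP.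
have Sin r l : (forall z, `|avgs l f z - avgs l f coloring_point| <= r) ->
    S (avgs l f coloring_point - r).
  by move=> lP; exists l => z; have := lP z; rewrite ler_distl => /andP[].
have Sub r l : (forall z, `|avgs l f z - avgs l f coloring_point| <= r) ->
    ubound S (avgs l f coloring_point + r).
  move=> lP b [l' bP].
  apply: (@le_trans _ _ (avgs l (avgs l' f) coloring_point)).
    rewrite -[leLHS](congr1 (fun f => f coloring_point) (avgs_cst l _)).
    exact: avgs_le.
  rewrite avgsC -[leRHS](congr1 (fun f => f coloring_point) (avgs_cst l' _)).
  by apply: avgs_le => z; have := lP z; rewrite ler_distl => /andP[].
exists (sup S) => r r0; have r2 : 0 < r / 2 by rewrite divr_gt0.
have [l lP] := osc _ r2; exists l => z.
have supS : has_sup S by split; [eexists; exact: Sin lP|eexists; exact: Sub lP].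
have : avgs l f coloring_point - r / 2 <= sup S.
  by apply: ub_le_sup; [exact: supS.2|exact: Sin].
have : sup S <= avgs l f coloring_point + r / 2.
  by apply: ge_sup; [exact: supS.1|exact: Sub].
by have := lP z; rewrite !ler_distl => /andP[? ?] *; apply/andP; split; lra.
Qed.

(** Uniform continuity: pairs that agree on ever longer initial segments of the enumeration, with
    values more than [r] apart, would cluster at a point near which [f] varies by less than
    [r / 2]. *)
Lemma continuous_depends_on f : continuous f ->
  forall r, 0 < r -> exists l, depends_on l r f.
Proof.
move=> fc r r0; apply: contrapT => nl.
have bad N : exists xy : X * X,
    (forall n, (n <= N)%N -> colp xy.1 (e n) = colp xy.2 (e n)) /\
    r < `|f xy.1 - f xy.2|.
  apply: contrapT => nb; apply: nl; exists [seq e n | n <- iota 0 N.+1].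
  move=> x y xy; rewrite leNgt; apply/negP => rf; apply: nb; exists (x, y).
  split=> //= n nN; apply: xy; apply/mapP; exists n => //.
  by rewrite mem_iota.
have [xy xyP] := choice bad.
have [x [_ xcl]] : [set: X] `&` cluster ((fun n => (xy n).1) @ \oo) !=set0.
  by apply: coloring_compact; exact: filterT.
have r2 : 0 < r / 2 by rewrite divr_gt0.
have /nbhs_coloring[N NP] : nbhs x [set y | `|f x - f y| < r / 2].
  by move/cvgrPdist_lt: (fc x) => /(_ _ r2).
have [_ [[m Nm <-] ym]] := xcl ((fun n => (xy n).1) @` [set n | (N <= n)%N])
  [set y | forall n, (n <= N)%N -> colp x (e n) = colp y (e n)]
  (ltac:(by exists N => // n Nn; exists n))
  (ltac:(by apply/nbhs_coloring; exists N)).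
have [agree big] := xyP m.
have h1 := NP (xy m).1 ym.
have h2 : `|f x - f (xy m).2| < r / 2.
  by apply: NP => n nN; rewrite ym// agree// (leq_trans nN).
have := ler_distD (f x) (f (xy m).1) (f (xy m).2).
by move: h1 h2 => /=; rewrite (distrC (f x) (f (xy m).1)); lra.
Qed.

End Coloring.

(** * The reduced norm and Kesten's criterion *)

Section ComplexContinuity.
Context {R : realType}.

Lemma lipschitz_comp_continuous (X : ptopologicalType) (f : contC R[i] X)
    (h : R[i] -> R) :
  (forall z w, `|h z - h w| <= cabs (z - w)) -> continuous (fun x => h (f x)).
Proof.
move=> hl x; apply/cvgrPdist_lt => e e0.
have /cvgrPdist_lt/(_ e%:C) := @contC_cont _ _ f x.
rewrite ltr0_complex => /(_ e0).
apply: filterS => y; rewrite -cabsE ltcR; exact: le_lt_trans.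
Qed.

Lemma real_complex_continuous (X : topologicalType) (g : X -> R) :
  continuous g -> continuous ((fun x => (g x)%:C) : X -> (R[i] : numClosedFieldType)).
Proof.
move=> gc x; apply/cvgrPdist_lt => _ /complex_pos_exists[e e0 ->].
have /cvgrPdist_lt/(_ _ e0) := gc x; apply: filterS => y.
by rewrite -rmorphB -cabsE cabs_real ltcR.
Qed.

Lemma cabs_lip (z w : R[i]) : `|cabs z - cabs w| <= cabs (z - w).
Proof.
have le (a b : R[i]) : cabs a - cabs b <= cabs (a - b).
  by rewrite lerBlDr -[in leLHS](subrK b a) cabsD.
by rewrite ler_norml le andbT lerNl opprB -[leRHS]cabsN opprB le.
Qed.

Lemma Re_lip (z w : R[i]) : `|complex.Re z - complex.Re w| <= cabs (z - w).
Proof.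
by apply: le_trans (Re_le_cabs _); case: z w => [? ?] [? ?].
Qed.

Lemma Im_lip (z w : R[i]) : `|complex.Im z - complex.Im w| <= cabs (z - w).
Proof.
have := Re_lip ('i * z) ('i * w).
rewrite -mulrBr cabsM cabs_im mul1r; apply: le_trans.
have Rei (y : R[i]) : complex.Re ('i * y) = - complex.Im y.
  case: y => a b; rewrite -[LHS]/(complex.Re ((0 +i* 1)%C * (a +i* b)%C)) /=.
  by rewrite mul0r mul1r sub0r.
by rewrite !Rei -opprD normrN.
Qed.

End ComplexContinuity.

Section ContinuousFunctions.
Context {R : realType} {X : ptopologicalType}.
Implicit Types (f g w : contC R[i] X).

Lemma contC_addE f g x : contC_fun (f + g) x = f x + g x. Proof. by []. Qed.
Lemma contC_mulE f g x : contC_fun (f * g) x = f x * g x. Proof. by []. Qed.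
Lemma contC_scaleE k f x : contC_fun (k *: f) x = k * f x. Proof. by []. Qed.
Lemma contC_starE f x : contC_fun (star f) x = (f x)^*. Proof. by []. Qed.

Lemma contC_sumE (I : Type) (r : seq I) (F : I -> contC R[i] X) x :
  contC_fun (\sum_(i <- r) F i) x = \sum_(i <- r) F i x.
Proof. by elim/big_rec2: _ => // i y z _ <-. Qed.

Definition real_contC (g : X -> R) (gc : continuous g) : contC R[i] X :=
  mkcontC (real_complex_continuous gc).

Lemma contC_bounded f : compact [set: X] ->
  exists2 M : R, 0 < M & forall x, cabs (f x) <= M.
Proof.
move=> Xc.
have fc : continuous (fun x => cabs (f x)).
  exact: lipschitz_comp_continuous cabs_lip.
have /compact_bounded := continuous_compact (continuous_subspaceT fc) Xc.
move=> /ex_strict_bound_gt0[M M0 MP]; exists M => // x.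
have /= := MP (cabs (f x)); rewrite ger0_norm ?cabs_ge0// => h.
by apply/ltW/h; exists x.
Qed.

Lemma conjC_cart (h s : R) : (h%:C + 'i * s%:C)^* = h%:C - 'i * s%:C.
Proof. by rewrite rmorphD/= rmorphM/= conjCi !conjC_real_complex mulNr. Qed.

Lemma unit_circle_real (h s : R) : h ^+ 2 + s ^+ 2 = 1 ->
  (h%:C + 'i * s%:C)^* * (h%:C + 'i * s%:C) = 1.
Proof.
move=> hs; rewrite conjC_cart -subr_sqr exprMn sqrCi mulN1r opprK.
by rewrite -!(rmorphXn (real_complex R)) -(rmorphD (real_complex R)) hs.
Qed.

(* A real function [h] with values in [-1, 1] is the real part of the unitary
   [h + i sqrt (1 - h^2)]. *)
Lemma contC_unitary_span (P : contC R[i] X -> Prop) : compact [set: X] ->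
  (forall f g, P f -> P g -> P (f + g)) -> (forall k f, P f -> P (k *: f)) ->
  (forall w, star w * w = 1 -> P w) -> forall f, P f.
Proof.
move=> Xc PD PZ PU.
have Preal (h : X -> R) (hc : continuous h) : (forall x, `|h x| <= 1) ->
    P (real_contC hc).
  move=> h1; pose s x := Num.sqrt (1 - h x ^+ 2).
  have sc : continuous s.
    move=> x; apply: (@continuous_comp _ _ _ (fun x => 1 - h x ^+ 2) Num.sqrt).
      apply: cvgB; first exact: cvg_cst.
      by apply: cvgM; exact: hc.
    exact: sqrt_continuous.
  pose w := real_contC hc + 'i *: real_contC sc.
  have hs x : h x ^+ 2 + s x ^+ 2 = 1.
    rewrite sqr_sqrtr ?subrKC// subr_ge0 -real_normK ?num_real//.
    by rewrite expr_le1.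
  have wU : star w * w = 1.
    by apply: contCP => x; exact: unit_circle_real (hs x).
  have wsU : star (star w) * star w = 1.
    rewrite starK -wU; apply: contCP => x.
    by rewrite !contC_mulE mulrC.
  have -> : real_contC hc = (2^-1)%:C *: (w + star w).
    apply: contCP => x.
    rewrite contC_scaleE contC_addE contC_starE contC_addE contC_scaleE.
    rewrite !mkcontCE conjC_cart.
    rewrite addrACA subrr addr0 -rmorphD -rmorphM/=.
    by congr (_%:C); field.
  by apply: PZ; apply: PD; exact: PU.
move=> f; have [M M0 fM] := contC_bounded f Xc.
have scale_cont (h : X -> R) : continuous h -> continuous (fun x => M^-1 * h x).
  by move=> hc x; apply: cvgM; [exact: cvg_cst|exact: hc].
have rc := scale_cont _ (lipschitz_comp_continuous (f := f) Re_lip).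
have ic := scale_cont _ (lipschitz_comp_continuous (f := f) Im_lip).
have -> : f = M%:C *: (real_contC rc + 'i *: real_contC ic).
  apply: contCP => x.
  rewrite contC_scaleE contC_addE contC_scaleE !mkcontCE !rmorphM/=.
  have MM : M%:C * (M^-1)%:C = 1.
    by rewrite -(rmorphM (real_complex R)) mulfV ?gt_eqF// rmorph1.
  rewrite mulrDr [M%:C * ('i * _)]mulrCA !(mulrA M%:C) !MM !mul1r.
  by rewrite {1}[f x]complexE.
have bound (h : R[i] -> R) x : (forall z, `|h z| <= cabs z) -> `|M^-1 * h (f x)| <= 1.
  move=> hz; rewrite normrM gtr0_norm ?invr_gt0// mulrC ler_pdivrMr// mul1r.
  exact: le_trans (hz _) (fM x).
apply: (PZ); apply: PD; [|apply: PZ]; apply: Preal => x; apply: bound => z.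
  exact: Re_le_cabs.
by have := Im_lip z 0; rewrite !subr0.
Qed.

End ContinuousFunctions.

(** * Elements supported at one group element *)

Section Delta.
Context {R : realType} {G : groupType} {X : ptopologicalType}.
Context (alpha : top_action G X).
Local Notation C := (R[i]).
Local Notation D := (Cc C alpha).
Implicit Types (s t : G) (f g : contC C X) (a b : D).

Fact delta_fin s f : finite_set (supp (fun t => if t == s then f else 0)).
Proof.
apply: (@sub_finite_set _ _ [set s]) => // t; rewrite /supp /=.
by case: (t =P s) => // _; rewrite eqxx.
Qed.

(** The product of [f] with the canonical unitary [u_s], which is [delta s 1]. *)
Definition delta s f : D := MkCc alpha (delta_fin s f).

Lemma deltaE s f t : delta s f t = if t == s then f else 0.
Proof. by []. Qed.

Lemma embedE f : Cc_embed alpha f = delta 1%g f.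
Proof. exact: CcP. Qed.

Lemma delta11 : delta 1%g 1 = 1.
Proof. by rewrite -embedE. Qed.

Lemma Cc_addE a b t : (a + b) t = a t + b t. Proof. by []. Qed.
Lemma Cc_scaleE k a t : (k *: a) t = k *: a t. Proof. by []. Qed.
Lemma Cc_starE a t : (star a) t = star (translate alpha t (a t^-1%g)).
Proof. by []. Qed.

Lemma Cc_sumE (I : Type) (r : seq I) (F : I -> D) t :
  (\sum_(i <- r) F i) t = \sum_(i <- r) F i t.
Proof. by elim/big_rec2: _ => // i y z _ <-. Qed.

Lemma deltaD s f g : delta s (f + g) = delta s f + delta s g.
Proof. by apply: CcP => t; rewrite Cc_addE !deltaE; case: eqP; rewrite ?addr0. Qed.

Lemma deltaZ k s f : delta s (k *: f) = k *: delta s f.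
Proof. by apply: CcP => t; rewrite Cc_scaleE !deltaE; case: eqP; rewrite ?scaler0. Qed.

Lemma delta_mulE s f b t :
  (delta s f * b) t = f * translate alpha s (b (s^-1 * t)%g).
Proof.
rewrite -[LHS]/(Defs.conv alpha (delta s f) b t) (@convE _ _ _ _ _ _ [set s])//.
  by rewrite sum_fset1 deltaE eqxx.
by move=> r; rewrite /supp /=; case: (r =P s) => // _; rewrite eqxx.
Qed.

Lemma delta_star s f :
  star (delta s f) = delta s^-1%g (star (translate alpha s^-1%g f)).
Proof.
apply: CcP => t; rewrite Cc_starE !deltaE -[t == _]eqg_inv invgK.
case: eqP => [<-|_]; first by rewrite invgK.
by rewrite translate0 star0.
Qed.

Lemma delta_unitary s w : star w * w = 1 -> star (delta s w) * delta s w = 1.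
Proof.
move=> w1; apply: CcP => t; rewrite delta_star delta_mulE deltaE invgK.
have -> : ((s * t)%g == s) = (t == 1%g) by rewrite -{2}[s]mulg1 (inj_eq (@mulgI _ s)).
rewrite -delta11 deltaE; case: eqP => _; last by rewrite translate0 mulr0.
by rewrite -translate_star -translateM w1 translate_1.
Qed.

Lemma delta_sum a : a = \sum_(s <- fset_set (supp a)) delta s (a s).
Proof.
apply: CcP => t; rewrite Cc_sumE.
have [at0|at0] := eqVneq (a t) 0.
  rewrite at0 big1_seq// => s /andP[_ _]; rewrite deltaE.
  by case: eqP => // <-.
have tin : t \in fset_set (supp a).
  by rewrite in_fset_set ?inE//; exact: Cc_finite.
rewrite (bigD1_seq t tin (fset_uniq _))/= eqxx big1 ?addr0// => s.
by rewrite eq_sym => /negbTE ->.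
Qed.

(** The unitaries of [C(X)] span it, and [delta s w] is unitary when [w] is. *)
Lemma Cc_unitary_bounded (Xc : compact [set: X]) a : unitary_bounded a.
Proof.
rewrite (delta_sum a); apply: unitary_bounded_sum => s.
move: (a s); apply: (contC_unitary_span Xc) => [f g|k f|w w1].
- by rewrite deltaD; exact: unitary_boundedD.
- by rewrite deltaZ; exact: unitary_boundedZ.
- exact/unitary_bounded_unitary/delta_unitary.
Qed.

(** Summing over inverses exhibits the value at 1 as a sum of translated squares when [a = b], and
    lets an invariant state discard the translations in [koopman_star_mul]. *)
Lemma star_mulE a b t : (star a * b) t =
  \sum_(s \in [set: G])
    translate alpha s^-1%g (star (a s) * b (s * t)%g).
Proof.
rewrite -[LHS]/(Defs.conv alpha (star a) b t) /Defs.conv.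
rewrite (reindex_fsbigT (fun s => s^-1)%g); last first.
  by exists (fun s => s^-1)%g => u; rewrite invgK.
apply: eq_fsbigr => s _.
by rewrite Cc_starE !invgK -translate_star translateM.
Qed.

End Delta.

(** * Regular representations and almost invariant vectors *)

Section Regular.
Context {R : realType} {G : groupType} {X : ptopologicalType}.
Context (alpha : top_action G X) (Xc : compact [set: X]).
Local Notation C := (R[i]).
Local Notation D := (Cc C alpha).
Implicit Types (s t : G) (f g : contC C X) (a b : D) (x : X).

(** Restriction to the identity followed by evaluation at [x]; its GNS representation is the regular
    representation over the orbit of [x]. *)
Definition eval_functional x a : C := a 1%g x.

(* [orbit_vector x b] is the vector of l^2(G) obtained by applying [b] to the
   basis vector at 1 in the regular representation over the orbit of [x]. *)
Definition orbit_vector x b t : C := b t (alpha t x).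

Lemma eval_functional_sq x b (L : set G) : finite_set L -> supp b `<=` L ->
  eval_functional x (star b * b) =
  (\sum_(t <- fset_set L) cabs (orbit_vector x b t) ^+ 2)%:C.
Proof.
move=> finL bL; rewrite /eval_functional star_mulE (fsum_supp finL); last first.
  move=> s; rewrite /supp /= => h; apply: bL; apply: contra_neq h => bs.
  by rewrite mulg1 bs mulr0 translate0.
rewrite contC_sumE rmorph_sum/=; apply: eq_bigr => s _.
rewrite -[LHS]/(contC_fun (star (b s) * b (s * 1)%g) (alpha s^-1^-1%g x)).
by rewrite cabs_sq invgK mulg1 contC_mulE contC_starE.
Qed.

Lemma eval_functional_positive x : positive_functional (@eval_functional x).
Proof.
split=> // [a|a].
  by rewrite /eval_functional Cc_starE contC_starE invg1 translate1.
rewrite (eval_functional_sq x (Cc_finite a) (@subset_refl _ _)) ler0c.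
by apply: sumr_ge0 => s _; exact: sqr_ge0.
Qed.

Lemma orbit_vector_delta x s b t :
  orbit_vector x (delta alpha s 1 * b) t = orbit_vector x b (s^-1 * t)%g.
Proof.
by rewrite /orbit_vector delta_mulE mul1r mkcontCE actM.
Qed.

Local Notation vnorm x := (gns_vnorm (eval_functional x)).

Lemma eval_vnorm_sq x b (L : set G) : finite_set L -> supp b `<=` L ->
  vnorm x b ^+ 2 = \sum_(t <- fset_set L) cabs (orbit_vector x b t) ^+ 2.
Proof.
move=> finL bL; rewrite (gns_vnorm_sq (eval_functional_positive x)).
by rewrite (eval_functional_sq x finL bL).
Qed.

Let hbnd := @Cc_unitary_bounded R G X alpha Xc.

Definition regular_seminorms : set (D -> R) :=
  [set gns_seminorm (eval_functional x) | x in [set: X]].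

Definition reduced_norm : D -> R := sup_seminorm regular_seminorms.

Let regular_csn p : regular_seminorms p -> cstar_seminorm p.
Proof. by move=> [x _ <-]; apply: gns_seminorm_csn; [exact: eval_functional_positive|]. Qed.

Let regular_bnd a : exists K, forall p, regular_seminorms p -> p a <= K.
Proof.
have [K KP] := unitary_bounded_csn (hbnd a).
by exists K => p /regular_csn; exact: KP.
Qed.

Let regular0 : regular_seminorms !=set0.
Proof. by exists (gns_seminorm (eval_functional point)), point. Qed.

Lemma reduced_norm_csn : cstar_seminorm reduced_norm.
Proof. exact: sup_seminorm_csn regular0 regular_csn regular_bnd. Qed.

(** [a t y] is the coordinate at [t] of the vector of [a] over the orbit of [t^-1 y], and that
    vector vanishes with the norm. *)
Lemma reduced_norm_eq0 a : reduced_norm a = 0 -> a = 0.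
Proof.
move=> a0; apply: CcP => t; apply: contCP => y.
pose x := alpha t^-1%g y.
have hx := eval_functional_positive x.
have N0 : gns_seminorm (eval_functional x) a <= 0.
  by rewrite -a0; apply: (sup_seminorm_ge regular_bnd); exists x.
have : vnorm x a <= 0.
  rewrite -[a]mulr1 (le_trans (gns_vnormM hx hbnd _ _))// mulr_le0_ge0//.
  exact: gns_vnorm_ge0.
have [->//|at0] := eqVneq (a t) 0.
rewrite -[X in _ <= X](expr0n _ 2) => v0.
have v2 : vnorm x a ^+ 2 <= 0.
  have := gns_vnorm_ge0 (eval_functional x) a; move: v0; rewrite expr0n/=; nra.
move: v2; rewrite (eval_vnorm_sq x (Cc_finite a) (@subset_refl _ _)).
have tin : t \in fset_set (supp a).
  by rewrite in_fset_set ?inE//; exact: Cc_finite.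
rewrite (bigD1_seq t tin (fset_uniq _))/=.
move=> h; apply: cabs_eq0; apply/eqP; rewrite -sqrf_eq0 eq_le sqr_ge0 andbT.
have -> : y = alpha t x by rewrite /x -actM mulgV act1.
apply: le_trans h; rewrite lerDl; apply: sumr_ge0 => s _; exact: sqr_ge0.
Qed.

Definition group_sum (l : seq G) : D := \sum_(s <- l) delta alpha s 1.

Let vnorm_delta x s b : vnorm x (delta alpha s 1 * b) = vnorm x b.
Proof.
have [_ _ _ h] := gns_vnorm_seminorm (eval_functional_positive x).
by apply: h; apply: delta_unitary; rewrite star1 mulr1.
Qed.

Let vnorm_group_sum x l b : vnorm x (group_sum l * b) <= (size l)%:R * vnorm x b.
Proof.
have [_ hD hZ _] := gns_vnorm_seminorm (eval_functional_positive x).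
elim: l => [|s l IH]; rewrite /group_sum.
  by rewrite big_nil mul0r mul0r -(scale0r (0 : D)) hZ cabs0 mul0r.
rewrite big_cons mulrDl (le_trans (hD _ _))// vnorm_delta.
by rewrite /= -add1n natrD mulrDl mul1r lerD2l.
Qed.

(** Some [b] nearly attains the norm. Among the [k + 1] terms, those other than [u_s b] and [b]
    contribute at most [(k - 1) |b|], so [|u_s b + b| >= (2 - ep) |b|]. The parallelogram law then
    gives [|u_s b - b|^2 <= (4 ep - ep^2) |b|^2]. The extra term 1 is there so that [u_s b] is
    compared with [b] itself. *)
Lemma almost_invariant_vector l (ep : R) : 0 < ep <= 1 ->
  (size l).+1%:R <= reduced_norm (group_sum (1%g :: l)) ->
  exists x b, 0 < vnorm x b /\ forall s, s \in l ->
    vnorm x (delta alpha s 1 * b - b) ^+ 2 <= 4 * ep * vnorm x b ^+ 2.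
Proof.
move=> /andP[ep0 ep1] hl; set K := (size l).+1%:R - ep.
have K0 : 0 <= K by rewrite /K subr_ge0 (le_trans ep1)// ler1n.
have [x xP] : exists x, K < gns_seminorm (eval_functional x) (group_sum (1%g :: l)).
  apply: contrapT => nx.
  have : reduced_norm (group_sum (1%g :: l)) <= K.
    apply: (sup_seminorm_le regular0) => p [x _ <-]; rewrite leNgt; apply/negP => h.
    by apply: nx; exists x.
  by move=> /(le_trans hl); rewrite /K; lra.
have hx := eval_functional_positive x.
have [b bP] : exists b, K * vnorm x b < vnorm x (group_sum (1%g :: l) * b).
  apply: contrapT => nb; move: xP; rewrite ltNge => /negP; apply.
  apply: gns_seminorm_le => // c; rewrite leNgt; apply/negP => h.
  by apply: nb; exists c.
have [_ hD hZ _] := gns_vnorm_seminorm hx.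
have v0 := gns_vnorm_ge0 (eval_functional x) b.
exists x, b; split.
  rewrite lt_def v0 andbT; apply/eqP => b0; move: bP.
  rewrite b0 mulr0 ltNge => /negP; apply.
  by rewrite (le_trans (gns_vnormM hx hbnd _ _))// b0 mulr0.
move=> s sl.
have : vnorm x (group_sum (1%g :: l) * b) <=
    vnorm x (delta alpha s 1 * b + b) + (size l).-1%:R * vnorm x b.
  rewrite /group_sum big_cons (perm_big _ (perm_to_rem sl)) big_cons/=.
  rewrite addrA mulrDl delta11 mulrDl mul1r addrC [b + _]addrC addrC.
  by rewrite (le_trans (hD _ _))// lerD2l -(size_rem sl); exact: vnorm_group_sum.
have sl0 : (size l).+1%:R = 2 + (size l).-1%:R :> R.
  by rewrite -natrD; case: (l) sl.
move=> /(lt_le_trans bP); rewrite /K sl0 => h.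
have := gns_vnorm_parallelogram hx (delta alpha s 1 * b) b.
rewrite vnorm_delta.
have h2 : (2 - ep) * vnorm x b <= vnorm x (delta alpha s 1 * b + b).
  by move: h; lra.
have : ((2 - ep) * vnorm x b) ^+ 2 <= vnorm x (delta alpha s 1 * b + b) ^+ 2.
  by rewrite ler_pXn2r ?nnegrE ?gns_vnorm_ge0// mulr_ge0//; lra.
have : 0 <= ep ^+ 2 * vnorm x b ^+ 2 by rewrite mulr_ge0 ?sqr_ge0.
by rewrite exprMn; lra.
Qed.

(** Young's inequality with weight [d]. Used term by term, it replaces Cauchy-Schwarz in estimating
    the distance between two families of squared moduli. *)
Lemma sq_modulus_diff (z w : C) (d : R) : 0 < d ->
  `|cabs z ^+ 2 - cabs w ^+ 2| <=
  (2 * d)^-1 * cabs (z - w) ^+ 2 + d * (cabs z ^+ 2 + cabs w ^+ 2).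
Proof.
move=> d0; have := cabs_lip z w; rewrite subr_sqr normrM.
have z0 := cabs_ge0 z; have w0 := cabs_ge0 w.
rewrite (@ger0_norm _ (cabs z + cabs w)) ?addr_ge0//.
move: (cabs (z - w)) `|cabs z - cabs w| (normr_ge0 (cabs z - cabs w)) => u v v0 vu.
have h : v * (cabs z + cabs w) <= (2 * d)^-1 * v ^+ 2 + d / 2 * (cabs z + cabs w) ^+ 2.
  rewrite -subr_ge0.
  have -> : (2 * d)^-1 * v ^+ 2 + d / 2 * (cabs z + cabs w) ^+ 2
      - v * (cabs z + cabs w) = (2 * d)^-1 * (v - d * (cabs z + cabs w)) ^+ 2.
    by field; rewrite gt_eqF.
  by rewrite mulr_ge0 ?sqr_ge0// invr_ge0 mulr_ge0// ltW.
apply: (le_trans h); apply: lerD.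
  by rewrite ler_wpM2l ?invr_ge0 ?mulr_ge0 ?(ltW d0)// ler_pXn2r// nnegrE (le_trans v0).
by rewrite -mulrA ler_wpM2l ?(ltW d0)//; have := sqr_ge0 (cabs z - cabs w); nra.
Qed.

Definition almost_invariant_mean (l : seq G) (d : R) (m : set G -> R) : Prop :=
  [/\ forall A, 0 <= m A, m [set: G] = 1,
      forall A B, A `&` B = set0 -> m (A `|` B) = m A + m B &
      forall s A, s \in l -> `|m [set (s * t)%g | t in A] - m A| <= d].

(** The normalised squared coordinates of an almost invariant vector are the weights of a finitely
    supported probability measure. *)
Lemma almost_invariant_mean_exists l (d : R) : 0 < d <= 1 ->
  (forall l, (size l)%:R <= reduced_norm (group_sum l)) ->
  exists m, almost_invariant_mean l (4 * d) m.
Proof.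
(* Inverses, because the mass of [s A] for the weights of [b] is the mass of [A] for those of
   [u_(s^-1) b]. *)
move=> /andP[d0 d1] hr; pose l' := [seq s^-1%g | s <- l].
(* With [ep = d^2] each of the two terms of [sq_modulus_diff] sums to at most [2 d |b|^2], whence
   the bound [4 d]. *)
have [|x [b [b0 bP]]] := @almost_invariant_vector l' (d ^+ 2) _ (hr (1%g :: l')).
  by rewrite exprn_gt0//= expr_le1// ltW.
pose w t := cabs (orbit_vector x b t) ^+ 2.
have w0 t : 0 <= w t by exact: sqr_ge0.
have wsupp t : b t = 0 -> w t = 0 by rewrite /w /orbit_vector => ->; rewrite cabs0 expr0n.
pose V := vnorm x b ^+ 2.
have V0 : 0 < V by rewrite exprn_gt0.
pose F (A : set G) t : R := if `[< A t >] then w t else 0.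
have F0 A t : 0 <= F A t by rewrite /F; case: asboolP.
pose m A := V^-1 * \sum_(t <- fset_set (supp b)) F A t.
have mE (L : set G) (A : set G) : finite_set L -> supp b `<=` L ->
    m A = V^-1 * \sum_(t <- fset_set L) F A t.
  move=> finL bL; rewrite /m; congr (_ * _).
  rewrite -!fsbig_finite//; last exact: Cc_finite.
  apply: fsbig_widen => // t [_ /negP]; rewrite negbK => /eqP bt.
  by rewrite /= /F wsupp//; case: asboolP.
exists m; split.
- by move=> A; rewrite mulr_ge0 ?invr_ge0 ?(ltW V0)// sumr_ge0.
- rewrite /m /V (eval_vnorm_sq x (Cc_finite b) (@subset_refl _ _)).
  rewrite [X in _ * X](eq_bigr w) => [|t _]; last by rewrite /F asboolT.
  by rewrite mulVf// -(eval_vnorm_sq x (Cc_finite b) (@subset_refl _ _)) gt_eqF.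
- move=> A B AB; rewrite /m -mulrDr -big_split/=; congr (_ * _).
  apply: eq_bigr => t _; rewrite /F; case: (asboolP (A t)) => At.
    rewrite asboolT; last by left.
    rewrite asboolF ?addr0// => Bt.
    by rewrite -[False]/(set0 t) -AB.
  rewrite add0r; case: (asboolP (B t)) => Bt; last by rewrite asboolF// => -[].
  by rewrite asboolT//; right.
move=> s A sl; pose c := delta alpha s^-1%g 1 * b.
have cE t : orbit_vector x c t = orbit_vector x b (s * t)%g.
  by rewrite orbit_vector_delta invgK.
have ct t : c t = translate alpha s^-1%g (b (s * t)%g).
  by rewrite /c delta_mulE mul1r invgK.
pose L := supp b `|` supp c.
have finL : finite_set L by rewrite finite_setU; split; exact: Cc_finite.
have bL : supp b `<=` L by move=> t; left.
have cL : supp c `<=` L by move=> t; right.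
have dL : supp (c - b) `<=` L.
  move=> t; case: (eqVneq (b t) 0) => [bt h|bt _]; [right|by left].
  have cbt : (c - b) t = c t - b t by [].
  by move: h; rewrite /supp /mkset cbt bt subr0.
pose wc t := cabs (orbit_vector x c t) ^+ 2.
have msA : m [set (s * t)%g | t in A] =
    V^-1 * \sum_(t <- fset_set L) (if `[< A t >] then wc t else 0).
  pose sL := [set (s * t)%g | t in L].
  have finsL : finite_set sL by exact: finite_image.
  rewrite (@mE sL)//; last first.
    move=> t bt; exists (s^-1 * t)%g; last by rewrite mulVKg.
    right; rewrite /supp /mkset ct mulVKg.
    apply: contra_neq (bt : b t != 0) => h; apply: contCP => y.
    by have := congr1 (fun f : contC C X => f (alpha s^-1%g y)) h;
       rewrite mkcontCE invgK -actM mulgV act1.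
  congr (_ * _); rewrite -!fsbig_finite// /sL fsbig_image//=.
    apply: eq_fsbigr => t _; rewrite /F /wc cE /w.
    congr (if _ then _ else _); apply/asbool_equiv_eq; split=> [[u Au /mulgI <-]//|At].
    by exists t.
  by move=> t u _ _ /mulgI.
rewrite msA (mE L)// -mulrBr normrM gtr0_norm ?invr_gt0// mulrC.
rewrite ler_pdivrMr// -sumrB (le_trans (ler_norm_sum _ _ _))//.
apply: (@le_trans _ _ (\sum_(t <- fset_set L)
  ((2 * d)^-1 * cabs (orbit_vector x (c - b) t) ^+ 2 + d * (wc t + w t)))).
  apply: ler_sum => t _; rewrite /F; case: asboolP => _.
    exact: (sq_modulus_diff (orbit_vector x c t) (orbit_vector x b t) d0).
  have wc0 : 0 <= wc t by exact: sqr_ge0.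
  rewrite subrr normr0 addr_ge0// mulr_ge0 ?sqr_ge0 ?addr_ge0 ?(ltW d0)//.
  by rewrite invr_ge0 mulr_ge0// ltW.
rewrite big_split/= -!mulr_sumr big_split/=.
rewrite -(eval_vnorm_sq x finL dL) -(eval_vnorm_sq x finL bL).
rewrite -(eval_vnorm_sq x finL cL) vnorm_delta -/V.
have : vnorm x (c - b) ^+ 2 <= 4 * d ^+ 2 * V.
  by apply: bP; apply/mapP; exists s.
move: (vnorm x (c - b) ^+ 2) => v vV.
have : (2 * d)^-1 * v <= (2 * d)^-1 * (4 * d ^+ 2 * V).
  by rewrite ler_wpM2l// invr_ge0 mulr_ge0// ltW.
have -> : (2 * d)^-1 * (4 * d ^+ 2 * V) = 2 * d * V by field; rewrite gt_eqF.
by lra.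
Qed.

End Regular.

(** * The Koopman representation and the exotic ideal *)

Section UltraLimit.
Context {R : realType}.

Lemma ultra_limit (U : set_system nat) (UU : UltraFilter U) (x : nat -> R) :
  (forall n, 0 <= x n <= 1) -> exists l : R, x @ U --> l.
Proof.
move=> x01.
have [l [_ xl]] : `[0, 1]%classic `&` cluster (x @ U) !=set0.
  apply: (@segment_compact R 0 1).
  apply: (@filterS _ U _ setT) => [n _ /=|]; last exact: filterT.
  by rewrite in_itv/= x01.
exists l => B lB.
have [//|UB] := in_ultra_setVsetC (x @^-1` B) UU.
by have [y [yB /yB]] := xl (~` B) B UB lB.
Qed.

(** [mu n] is invariant under the first [n] listed elements up to [4 / (n + 1)]. A limit along a
    non-principal ultrafilter keeps additivity and makes the invariance exact. *)
Lemma amenable_of_almost_invariant (G : groupType) (e : nat -> G) :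
  (forall s, exists n, e n = s) ->
  (forall (l : seq G) (d : R), 0 < d <= 1 ->
    exists m, almost_invariant_mean l (4 * d) m) ->
  amenable R G.
Proof.
move=> esurj aim.
have /choice[mu muP] n : exists m,
    almost_invariant_mean [seq e k | k <- iota 0 n] (4 * n.+1%:R^-1 : R) m.
  by apply: aim; rewrite invr_gt0 ltr0n/= invf_le1// ler1n.
have [U [UU ooU]] := ultraFilterLemma (@eventually_filter).
have mu01 A n : 0 <= mu n A <= 1.
  have [mu0 mu1 muD _] := muP n; rewrite mu0/= -mu1.
  by rewrite -(setUv A) muD ?setICr// lerDl.
have /choice[m mP] A := @ultra_limit U UU (fun n => mu n A) (mu01 A).
exists m; split.
- move=> A; apply: (ler_cvg_to (@cvg_cst _ (0:R) nat U _) (mP A)).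
  by apply: nearW => n; case/andP: (mu01 A n).
- apply: (cvg_unique _ (mP setT)) => //.
  rewrite (_ : (fun n => mu n setT) = fun=> 1); first exact: cvg_cst.
  by apply/funext => n; have [] := muP n.
- move=> A B AB; apply: (cvg_unique _ (mP (A `|` B))) => //.
  rewrite (_ : (fun n => mu n _) = fun n => mu n A + mu n B).
    by apply: cvgD; exact: mP.
  by apply/funext => n; have [_ _ muD _] := muP n; exact: muD.
- move=> s A; apply/eqP; rewrite -subr_eq0 -normr_le0.
  apply/ler_addgt0Pl => r r0; rewrite addr0.
  have r4 : 0 < r / 4 by rewrite divr_gt0.
  have [k ek] := esurj s; have [N Nr] := inv_lt r4.
  apply: (ler_cvg_to (cvg_norm (cvgB (mP [set (s * t)%g | t in A]) (mP A)))
    (@cvg_cst _ r nat U _)).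
  (* [k < n] puts [s = e k] among the listed elements, and [N <= n] brings the error below [r]. *)
  apply: ooU; exists (maxn k.+1 N) => // n /=; rewrite geq_max => /andP[kn Nn].
  have [_ _ _ inv] := muP n.
  rewrite (le_trans (inv s A _))//.
    by rewrite -ek; apply/mapP; exists k => //; rewrite mem_iota.
  rewrite mulrC -ler_pdivlMr// (le_trans _ (ltW Nr))//.
  by rewrite lef_pV2 ?posrE ?ltr0n// ler_nat.
Qed.

End UltraLimit.

(** * The Koopman representation of an invariant state *)

Section Koopman.
Context {R : realType} {G : groupType} {X : ptopologicalType}.
Context (alpha : top_action G X) (Xc : compact [set: X]).
Local Notation C := (R[i]).
Local Notation D := (Cc C alpha).
Implicit Types (s t : G) (f g : contC C X) (a b : D).

Definition invariant_state (m : contC C X -> C) : Prop :=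
  [/\ [/\ forall f g, m (f + g) = m f + m g,
          forall k f, m (k *: f) = k * m f,
          forall f, m (star f) = (m f)^* &
          forall f, 0 <= m (star f * f)],
      m 1 = 1 & forall s f, m (translate alpha s f) = m f].

Context (m : contC C X -> C) (hm : invariant_state m).

(* The value at the constant function 1 of [a], acting on C(X) by the covariant
   representation. *)
Definition total a : contC C X := \sum_(s \in [set: G]) a s.

Lemma totalE a (L : set G) : finite_set L -> supp a `<=` L ->
  total a = \sum_(s <- fset_set L) a s.
Proof. exact: fsum_supp. Qed.

Lemma totalD a b : total (a + b) = total a + total b.
Proof.
pose L := supp a `|` supp b.
have finL : finite_set L by rewrite finite_setU; split; exact: Cc_finite.
have abL : supp (a + b) `<=` L.
  move=> t; rewrite /supp /mkset Cc_addE => h.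
  have [at0|] := eqVneq (a t) 0; last by left.
  by right; rewrite at0 add0r in h.
rewrite (totalE finL abL) (totalE finL (@subsetUl _ _ _)).
by rewrite (totalE finL (@subsetUr _ _ _)) -big_split.
Qed.

Lemma totalZ k a : total (k *: a) = k *: total a.
Proof.
rewrite !(totalE (Cc_finite a)) ?scaler_sumr// => t.
by rewrite /supp /mkset Cc_scaleE; apply: contra_neq => ->; rewrite scaler0.
Qed.

Lemma total_delta s f : total (delta alpha s f) = f.
Proof.
rewrite (@totalE _ [set s])// ?sum_fset1 ?deltaE ?eqxx// => t.
by rewrite /supp /mkset deltaE /=; case: (t =P s) => // _; rewrite eqxx.
Qed.

Let mD f g : m (f + g) = m f + m g. Proof. by have [[]] := hm. Qed.
Let mZ k f : m (k *: f) = k * m f. Proof. by have [[]] := hm. Qed.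
Let m0 : m 0 = 0. Proof. by rewrite -(scale0r (0 : contC C X)) mZ mul0r. Qed.
Let m_sum (I : Type) (r : seq I) (F : I -> contC C X) :
  m (\sum_(i <- r) F i) = \sum_(i <- r) m (F i).
Proof. exact: (big_morph _ mD m0). Qed.

Definition koopman a : C := m (total a).

(** Invariance removes the translations from the double sum, which then factors. Thus the form of
    [koopman] is the inner product of the functions [total a] and [total b] for [m]. *)
Lemma koopman_star_mul a b : koopman (star a * b) = m (star (total a) * total b).
Proof.
have [_ _ m_tr] := hm.
pose La := supp a; pose Lb := supp b.
pose S := [set (s^-1 * t)%g | s in La & t in Lb].
have finS : finite_set S by apply: finite_image2; exact: Cc_finite.
have Ssupp s t : a s != 0 -> b (s * t)%g != 0 -> S t.
  by move=> as0 bst; exists s => //; exists (s * t)%g => //; rewrite mulKg.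
have abS : supp (star a * b) `<=` S.
  move=> t; rewrite /supp /mkset star_mulE => /eqP h; apply: contrapT => nS.
  apply: h; apply: fsbig1 => s _.
  have [->|as0] := eqVneq (a s) 0; first by rewrite star0 mul0r translate0.
  have [->|bst] := eqVneq (b (s * t)%g) 0; first by rewrite mulr0 translate0.
  by case: nS; exact: Ssupp bst.
rewrite /koopman (totalE finS abS) m_sum.
under eq_bigr => t _.
  rewrite star_mulE (fsum_supp (Cc_finite a)); last first.
    move=> s; rewrite /supp /mkset; apply: contra_neq => ->.
    by rewrite star0 mul0r translate0.
  rewrite m_sum; under eq_bigr do rewrite m_tr.
  over.
rewrite /= exchange_big /= (totalE (Cc_finite a) (@subset_refl _ _)) star_sum.
rewrite mulr_suml m_sum big_seq [RHS]big_seq; apply: eq_bigr => s.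
rewrite in_fset_set ?inE; last exact: Cc_finite.
move=> as0; rewrite -m_sum -mulr_sumr; congr (m (_ * _)).
rewrite -(@fsum_supp _ _ _ (fun t => b (s * t)%g))//; last first.
  by move=> t; exact: Ssupp.
rewrite [RHS]/total [RHS](reindex_fsbigT (fun u => s * u)%g)//.
by exists (fun u => s^-1 * u)%g => u; rewrite ?mulKg ?mulVKg.
Qed.

Lemma koopman_positive : positive_functional koopman.
Proof.
have [[_ _ m_star m_pos] _ _] := hm; split=> [a b|k a|a|a].
- by rewrite /koopman totalD mD.
- by rewrite /koopman totalZ mZ.
- rewrite -[star a]mulr1 koopman_star_mul -(delta11 alpha) total_delta mulr1.
  exact: m_star.
- by rewrite koopman_star_mul.
Qed.

(** Every [u_s] fixes the constant function 1, so the sum multiplies this unit vector by the number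
    of terms. *)
Lemma koopman_group_sum l :
  (size l)%:R <= gns_seminorm koopman (group_sum alpha l).
Proof.
have [[_ _ m_star m_pos] m1 _] := hm; have hk := koopman_positive.
have tot : total (group_sum alpha l) = ((size l)%:R : R)%:C *: 1.
  elim: l => [|s l IH]; rewrite /group_sum.
    by rewrite big_nil -(scale0r (0 : D)) totalZ !scale0r.
  rewrite big_cons totalD total_delta IH /= -nat1r rmorphD rmorph1.
  by rewrite scalerDl scale1r.
have v (a : D) (k : R) : 0 <= k -> total a = k%:C *: 1 -> gns_vnorm koopman a = k.
  move=> k0 ta; apply/eqP; rewrite -(@eqrXn2 _ 2) ?gns_vnorm_ge0//.
  rewrite (gns_vnorm_sq hk) koopman_star_mul ta starZ star1 conjC_real_complex.
  rewrite -scalerAl mul1r scalerA mZ m1 mulr1.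
  by rewrite -(rmorphM (real_complex R)) /= expr2.
rewrite -(v (group_sum alpha l) (size l)%:R)// -[X in gns_vnorm _ X]mulr1.
have v1 : gns_vnorm koopman 1 = 1.
  by apply: v => //; rewrite -(delta11 alpha) total_delta rmorph1 scale1r.
have := gns_vnormM hk (@Cc_unitary_bounded R G X alpha Xc) (group_sum alpha l) 1.
by rewrite v1 !mulr1.
Qed.

End Koopman.

Section ColoringState.
Context {R : realType} {G : groupType} {e : nat -> G * G}.
Context (he : forall i, exists n, e n = i).
Local Notation X := (@coloring G e R he).
Local Notation C := (R[i]).
Implicit Types (f g : contC C X).

(** Real and imaginary parts are averaged separately; the required identities follow from the
    uniqueness of means. *)
Lemma coloring_invariant_state :
  exists m : contC C X -> C, invariant_state (@coloring_action G e R he) m.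
Proof.
have /choice[mr mrP] f : exists c, has_mean (fun x => complex.Re (f x)) c.
  apply: has_mean_exists; apply: continuous_depends_on.
  exact: lipschitz_comp_continuous Re_lip.
have /choice[mi miP] f : exists c, has_mean (fun x => complex.Im (f x)) c.
  apply: has_mean_exists; apply: continuous_depends_on.
  exact: lipschitz_comp_continuous Im_lip.
have meq (h h' : X -> R) c d : has_mean h c -> has_mean h' d ->
    (forall x, h x = h' x) -> c = d.
  by move=> hc h'd /funext hh; apply: has_mean_uniq hc _; rewrite hh.
pose m f : C := Complex (mr f) (mi f).
have ReD (z w : C) : complex.Re (z + w) = complex.Re z + complex.Re w.
  by case: z w => [? ?] [? ?].
have ImD (z w : C) : complex.Im (z + w) = complex.Im z + complex.Im w.
  by case: z w => [? ?] [? ?].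
have ReJ (z : C) : complex.Re z^* = complex.Re z by case: z.
have ImJ (z : C) : complex.Im z^* = -1 * complex.Im z.
  by case: z => ? ?; rewrite mulN1r.
have ReM (z w : C) : complex.Re (z * w) =
    complex.Re z * complex.Re w + - complex.Im z * complex.Im w.
  by case: z w => [? ?] [? ?]; rewrite mulNr.
have ImM (z w : C) : complex.Im (z * w) =
    complex.Re z * complex.Im w + complex.Im z * complex.Re w.
  by case: z w => [? ?] [? ?].
have meqC (z w : C) : complex.Re z = complex.Re w -> complex.Im z = complex.Im w -> z = w.
  by case: z w => [? ?] [? ?] /= -> ->.
exists m; split; [split|..].
- move=> f g; apply: meqC; rewrite (ReD, ImD)/=.
    by apply: (meq _ _ _ _ (mrP _) (has_meanD (mrP f) (mrP g))) => x; rewrite -ReD.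
  by apply: (meq _ _ _ _ (miP _) (has_meanD (miP f) (miP g))) => x; rewrite -ImD.
- move=> k f; apply: meqC; rewrite (ReM, ImM)/=.
    apply: (meq _ _ _ _ (mrP _) (has_meanD (has_meanZ (complex.Re k) (mrP f))
      (has_meanZ (- complex.Im k) (miP f)))) => x; exact: ReM.
  apply: (meq _ _ _ _ (miP _) (has_meanD (has_meanZ (complex.Re k) (miP f))
    (has_meanZ (complex.Im k) (mrP f)))) => x; exact: ImM.
- move=> f; apply: meqC; rewrite (ReJ, ImJ)/=.
    by apply: (meq _ _ _ _ (mrP _) (mrP f)) => x; exact: ReJ.
  by apply: (meq _ _ _ _ (miP _) (has_meanZ (-1) (miP f))) => x; exact: ImJ.
- move=> f.
  have ffE x : contC_fun (star f * f) x = (cabs (f x) ^+ 2)%:C.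
    by rewrite cabs_sq.
  have -> : m (star f * f) = (mr (star f * f))%:C.
    apply: meqC => //=.
    apply: (meq _ _ _ _ (miP _) (has_mean_cst 0)) => x.
    by rewrite ffE.
  rewrite ler0c; apply: has_mean_ge0 (mrP _) => x.
  by rewrite ffE /= sqr_ge0.
- apply: meqC => /=.
    exact: (meq _ _ _ _ (mrP _) (has_mean_cst 1)).
  exact: (meq _ _ _ _ (miP _) (has_mean_cst 0)).
- move=> s f; apply: meqC => /=.
    exact: (meq _ _ _ _ (mrP _) (has_mean_gact s^-1%g (mrP f))).
  exact: (meq _ _ _ _ (miP _) (has_mean_gact s^-1%g (miP f))).
Qed.

End ColoringState.

(** * The full crossed product and the kernel of the reduced norm *)

Section FullCrossedProduct.
Context {R : realType} {G : groupType} {X : ptopologicalType}.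
Context (alpha : top_action G X) (Xc : compact [set: X]).
Local Notation C := (R[i]).
Local Notation D := (Cc C alpha).
Implicit Types (a : D) (q : D -> R).

Definition full_norm : D -> R := sup_seminorm [set q | cstar_seminorm q].

Let csn_nonempty : [set q : D -> R | cstar_seminorm q] !=set0.
Proof. by exists (@reduced_norm R G X alpha); exact: reduced_norm_csn. Qed.

Let csn_bnd a : exists K, forall q, [set q | cstar_seminorm q] q -> q a <= K.
Proof.
by have [K KP] := unitary_bounded_csn (@Cc_unitary_bounded R G X alpha Xc a); exists K.
Qed.

Lemma full_norm_csn : cstar_seminorm full_norm.
Proof. exact: (sup_seminorm_csn csn_nonempty (fun q hq => hq) csn_bnd). Qed.

Lemma full_norm_ge q a : cstar_seminorm q -> q a <= full_norm a.
Proof. by move=> hq; apply: (sup_seminorm_ge csn_bnd). Qed.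

Lemma full_norm_eq0 a : full_norm a = 0 -> a = 0.
Proof.
move=> a0; apply: (reduced_norm_eq0 Xc); apply/eqP; rewrite eq_le.
rewrite (csn_ge0 (reduced_norm_csn alpha Xc)) andbT -a0.
by apply: full_norm_ge; exact: reduced_norm_csn.
Qed.

Let A : cstarAlgType C := completion full_norm_csn full_norm_eq0.
Let j : {lrmorphism D -> A} := @cp_embed R D full_norm full_norm_csn full_norm_eq0.
Let pp : forall a, full_norm a <= full_norm a := fun a => lexx _.

Let j_norm a : rnorm (j a) = full_norm a.
Proof. by rewrite completion_rnorm (extend_embed full_norm_csn full_norm_eq0 full_norm_csn pp). Qed.

Fact fcp_largest : largest_cstar_norm (fun a => cnorm (j a)).
Proof.
have E : (fun a => cnorm (j a)) = fun a => (full_norm a)%:C.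
  by apply/funext => a; rewrite -rnormE j_norm.
rewrite E; split; first exact: csn_cstar_norm full_norm_csn full_norm_eq0.
move=> q /cstar_norm_csn[hq qE] a; rewrite -qE lecR.
exact: (full_norm_ge a hq).
Qed.

Fact fcp_dense_range : cclosure (range j) = [set: A].
Proof.
apply/seteqP; split=> // x _ _ /complex_pos_exists[e e0 ->].
have e2 : 0 < e / 2 by rewrite divr_gt0.
have [d dP] := cp_embed_dense x e2.
exists (j d); first by exists d.
rewrite -rnormE ltcR completion_rnorm (le_lt_trans dP)//.
by rewrite ltr_pdivrMr// ltr_pMr// ltr1n.
Qed.

Definition crossed_product : fullCrossedProduct C alpha :=
  FullCrossedProduct (@cp_embed_star _ _ _ full_norm_csn full_norm_eq0)
    fcp_largest fcp_dense_range.

Let r := @reduced_norm R G X alpha.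
Let hr : cstar_seminorm r := reduced_norm_csn alpha Xc.
Let rp a : r a <= full_norm a := full_norm_ge a hr.

(** The kernel of the canonical map onto the reduced crossed product, described without forming that
    quotient. *)
Definition reduced_kernel : set crossed_product :=
  [set x | extend_seminorm r x = 0].

Let rbar : A -> R := extend_seminorm r.
Let rbar_csn : cstar_seminorm rbar := extend_csn full_norm_csn full_norm_eq0 hr rp.
Let rbar_le x : rbar x <= rnorm x := extend_le x hr rp.
Let rbar_j a : rbar (j a) = r a := extend_embed full_norm_csn full_norm_eq0 hr rp a.

Lemma reduced_kernel_ideal : closed_ideal reduced_kernel.
Proof.
have le0 (x : A) : rbar x <= 0 -> reduced_kernel x.
  by move=> x0; apply/eqP; rewrite eq_le x0 (csn_ge0 rbar_csn).
split.
- move=> x xcl; apply: le0; apply/ler_addgt0Pl => e e0; rewrite addr0.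
  have [|y y0 xy] := xcl e%:C; first by rewrite ltr0_complex.
  rewrite -[x](subrK y) (le_trans (csnD rbar_csn _ _))// [rbar y]y0 addr0.
  by rewrite (le_trans (rbar_le _))// ltW// -ltcR rnormE.
- exact: (csn0 rbar_csn).
- move=> x y x0 y0; apply: le0.
  by rewrite (le_trans (csnD rbar_csn _ _))// [rbar x]x0 [rbar y]y0 addr0.
- move=> a x x0; split; apply: le0; rewrite (le_trans (csnM rbar_csn _ _))//.
    by rewrite [rbar x]x0 mulr0.
  by rewrite [rbar x]x0 mul0r.
Qed.

Lemma reduced_kernel_contC : reduced_kernel `&` fcp_contC crossed_product = [set 0].
Proof.
apply/seteqP; split=> x.
  move=> [x0 [f _ fx]]; move: x0; rewrite /reduced_kernel /= -fx => x0.
  have /(reduced_norm_eq0 Xc) f0 : r (Cc_embed alpha f) = 0.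
    by rewrite -rbar_j.
  by rewrite f0 rmorph0.
move=> ->; split; first exact: (csn0 rbar_csn).
exists 0 => //; rewrite (_ : Cc_embed alpha 0 = 0) ?rmorph0//.
by apply: CcP => t /=; case: ifP.
Qed.

(* If the extended reduced norm is a norm on the complete algebra [A], it is
   the norm of [A]. *)
Lemma reduced_kernel_neq0 a : r a < full_norm a -> reduced_kernel <> [set 0].
Proof.
move=> ra J0.
have rbar0 (x : A) : rbar x = 0 -> x = 0.
  by move=> x0; have : reduced_kernel x by []; rewrite J0.
(* With trivial kernel, [A] embeds injectively and contractively into its completion for [rbar];
   isometry would force [r a = full_norm a]. *)
pose phi : {lrmorphism A -> completion rbar_csn rbar0} :=
  @cp_embed R A rbar rbar_csn rbar0.
have phi_norm x : rnorm (phi x) = rbar x.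
  by rewrite completion_rnorm (extend_embed rbar_csn rbar0 rbar_csn (fun y => lexx _)).
have phi_inj x : phi x = 0 -> x = 0.
  by move=> x0; apply: (rbar0); rewrite -phi_norm x0 (csn0 rnorm_csn).
have := @injective_star_morphism_isometric _ _ _ phi (@cp_embed_star _ _ _ rbar_csn rbar0)
  phi_inj (j a).
rewrite phi_norm => /(_ (rbar_le _)); rewrite rbar_j j_norm => raE.
by move: ra; rewrite raE ltxx.
Qed.

End FullCrossedProduct.

Theorem theorem3p1 (R : realType) (G : groupType)
    (hcount : ([set: G] #= [set: nat])%card)
    (hnonam : ~ amenable R G) :
  exists (X : pmetricType R) (alpha : top_action G X),
    [/\ compact [set: X],
        free_action alpha &
        exists (A : fullCrossedProduct R[i] alpha) (J : set A),
          exotic_ideal J].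
Proof.
have [c cinj] : exists c : G -> nat, injective c.
  have /card_set_bijP[c [_ cinj _]] := hcount.
  by exists c => s t; apply: cinj; rewrite inE.
(* Only the surjectivity of [e1] and [e2] matters, so indices that code nothing may take default
   values. *)
pose e1 n : G := xget 1%g [set s | c s = n].
have e1P s : e1 (c s) = s.
  by apply: cinj; apply: (@xgetPex _ 1%g [set t | c t = c s]); exists s.
pose e2 n : G * G :=
  if choice.unpickle n is Some (k, l) then (e1 k, e1 l) else (1%g, 1%g).
have he i : exists n, e2 n = i.
  exists (choice.pickle (c i.1, c i.2)).
  by rewrite /e2 choice.pickleK !e1P -surjective_pairing.
pose X : pmetricType R := @coloring G e2 R he.
pose alpha : top_action G X := coloring_action (he := he).
have Xc : compact [set: X] := coloring_compact (he := he).
exists X, alpha; split=> //; first exact: coloring_action_free.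
exists (crossed_product alpha Xc), (@reduced_kernel R G X alpha Xc).
split; [exact: reduced_kernel_ideal| |exact: reduced_kernel_contC].
have [m hm] := @coloring_invariant_state R G e2 he.
have [l lP] : exists l, reduced_norm (group_sum alpha l) < (size l)%:R :> R.
  apply: contrapT => nl; apply: hnonam.
  apply: (amenable_of_almost_invariant (e := e1)) => [s|l d d01].
    by exists (c s).
  apply: (almost_invariant_mean_exists (alpha := alpha) Xc) => // l'.
  by rewrite leNgt; apply/negP => h; apply: nl; exists l'.
apply: (@reduced_kernel_neq0 _ _ _ _ _ (group_sum alpha l)).
apply: (lt_le_trans lP); apply: le_trans (koopman_group_sum Xc hm l) _.
apply: full_norm_ge => //; apply: gns_seminorm_csn.
  exact: koopman_positive.
exact: Cc_unitary_bounded.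
Qed.
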